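(* Let $X$ be either a (complex) $\mathcal{L}_r$-space with $1\le r\le\infty$, or the Schatten class $\mathcal{S}_r$ with $2\le r\le\infty$. Then cotype and hypercontractive homogeneous cotype coincide in $X$: for every $2\le q<\infty$, $X$ has cotype $q$ if and only if $X$ has hypercontractive homogeneous cotype $q$.
   Context: $\mathbb{T}=\{z\in\mathbb{C}:|z|=1\}$; $\mathbb{T}^N$ and $\mathbb{T}^\infty$ carry the product of the normalized Lebesgue measure on $\mathbb{T}$, denoted $dz$. $\mathbb{N}_0^{(\mathbb{N})}$ is the set of finite multi-indices of nonnegative integers of arbitrary length; $|\alpha|=\alpha_1+\alpha_2+\cdots$ and $z^\alpha=z_1^{\alpha_1}z_2^{\alpha_2}\cdots$. Cotype: $X$ has cotype $q$ if there is $C>0$ with $\big(\sum_{k=1}^N\|x_k\|^q\big)^{1/q}\le C\big(\int_{\mathbb{T}^N}\|\sum_{k=1}^Nx_kz_k\|^2dz\big)^{1/2}$ for all $N$ and $x_1,\dots,x_N\in X$. Hypercontractive homogeneous cotype: $X$ has hypercontractive homogeneous cotype $q$ if there is $C>0$ such that for every $m\in\mathbb{N}$ and every family $(x_\alpha)_{\alpha\in\mathbb{N}_0^{(\mathbb{N})},|\alpha|=m}\subset X$ with finitely many nonzero elements, $\big(\sum_{|\alpha|=m}\|x_\alpha\|^q\big)^{1/q}\le C^m\big(\int_{\mathbb{T}^\infty}\|\sum_{|\alpha|=m}x_\alpha z^\alpha\|^2dz\big)^{1/2}$. A Banach space $X$ is an $\mathcal{L}_r$-space if there is $\lambda>1$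 such that every finite dimensional subspace $E\subset X$ is contained in a finite dimensional subspace $F\subset X$ whose Banach–Mazur distance to $\ell_r^{\dim F}$ is at most $\lambda$. $\mathcal{S}_r$ is the Schatten $r$-class of operators on $\ell_2$ (for $r=\infty$, the compact operators with the operator norm). *)

(* Defs.v *)
From HB Require Import structures.
From mathcomp Require Import all_boot all_order all_algebra.
From mathcomp Require Import complex ring.
From mathcomp Require Import all_classical all_reals all_analysis.

Set Implicit Arguments.
Unset Strict Implicit.
Unset Printing Implicit Defensive.

Import Order.TTheory GRing.Theory Num.Theory.
Import numFieldNormedType.Exports.

Local Open Scope classical_set_scope.
Local Open Scope ring_scope.
Local Open Scope complex_scope.

(* In a normed space over R[i], `|v| is itself an element of R[i]; rnorm is
   the same norm with values in R. *)
Definition rnorm (R : realType) (V : normedZmodType R[i]) (v : V) : R :=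
  complex.Re `|v|.

Section rnorm_theory.
Context {R : realType}.

Lemma rnormE (V : normedZmodType R[i]) (v : V) : (rnorm v)%:C = `|v|.
Proof. by rewrite RRe_real// normr_real. Qed.

Lemma rnorm_ge0 (V : normedZmodType R[i]) (v : V) : 0 <= rnorm v.
Proof. by rewrite -lecR rnormE normr_ge0. Qed.

Lemma rnorm0 (V : normedZmodType R[i]) : rnorm (0 : V) = 0.
Proof. by rewrite /rnorm normr0. Qed.

Lemma rnorm0_eq0 (V : normedZmodType R[i]) (v : V) : rnorm v = 0 -> v = 0.
Proof. by move=> v0; apply/normr0_eq0; rewrite -rnormE v0. Qed.

Lemma ler_rnormD (V : normedZmodType R[i]) (v w : V) :
  rnorm (v + w) <= rnorm v + rnorm w.
Proof. by rewrite -lecR rmorphD/= !rnormE ler_normD. Qed.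

Lemma rnormM (z w : R[i]) : rnorm (z * w) = rnorm z * rnorm w.
Proof. by apply: complexI; rewrite rmorphM/= !rnormE normrM. Qed.

End rnorm_theory.

Section torus.
Context {R : realType}.
Implicit Types n : nat.

Let T := measurableTypeR R.

Definition tuple_cons n (p : T * n.-tuple T) : n.+1.-tuple T :=
  [tuple of p.1 :: p.2].

Lemma measurable_tuple_cons n : measurable_fun setT (@tuple_cons n).
Proof. exact: measurable_cons. Qed.

HB.instance Definition _ n := isMeasurableFun.Build _ _ _ _ (@tuple_cons n)
  (@measurable_tuple_cons n).

Lemma twopi_gt0 : (0 : R) < pi *+ 2.
Proof. by rewrite mulrn_wgt0// pi_gt0. Qed.

(* The N-fold product of the normalized Lebesgue measure on T, read in the
   coordinates (t_1, ..., t_N) of [0, 2pi]^N with z_k = e^{i t_k}. *)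
Fixpoint torus_prob n : probability (n.-tuple T) R :=
  match n with
  | 0 => \d_ [tuple]
  | n'.+1 => distribution (uniform_prob twopi_gt0 \x torus_prob n')%E
                          (@tuple_cons n')
  end.

Definition expi (t : R) : R[i] := cos t +i* sin t.

Definition torus_int n (f : n.-tuple R[i] -> R) : R :=
  \int[torus_prob n]_t f (map_tuple expi t).

End torus.

Section cotype.
Context {R : realType} (X : completeNormedModType R[i]).

Definition cotype (q : R) : Prop :=
  exists2 C : R, 0 < C & forall (N : nat) (x : 'I_N -> X),
    (\sum_(k < N) rnorm (x k) `^ q) `^ q^-1 <=
    C * Num.sqrt (torus_int (fun z : N.-tuple R[i] =>
                    rnorm (\sum_(k < N) tnth z k *: x k) ^+ 2)).

Definition multi_index (N m : nat) := {ffun 'I_N -> 'I_m.+1}.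

Definition degree N m (a : multi_index N m) : nat := (\sum_(i < N) a i)%N.

Definition monomial N m (z : N.-tuple R[i]) (a : multi_index N m) : R[i] :=
  \prod_(i < N) tnth z i ^+ a i.

(* A family (x_a)_{|a| = m} with finitely many nonzero members involves only
   finitely many variables z_1, ..., z_N, and the integral over the infinite
   torus of a function of these variables is its integral over T^N.  The
   constant C is uniform in N.  The bound a i <= m built into multi_index is
   implied by degree a = m; the values of x off degree m are irrelevant. *)
Definition hypercontractive_homogeneous_cotype (q : R) : Prop :=
  exists2 C : R, 0 < C &
  forall (m N : nat) (x : multi_index N m -> X), (0 < m)%N ->
    (\sum_(a | degree a == m) rnorm (x a) `^ q) `^ q^-1 <=
    C ^+ m * Num.sqrt (torus_int (fun z : N.-tuple R[i] =>
               rnorm (\sum_(a | degree a == m) monomial z a *: x a) ^+ 2)).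

End cotype.

Section Lr_spaces.
Context {R : realType}.

Definition lr_norm (r : \bar R) n (a : 'rV[R[i]]_n) : R :=
  match r with
  | r'%:E => (\sum_(i < n) rnorm (a 0 i) `^ r') `^ r'^-1
  | _ => \big[Num.max/0]_(i < n) rnorm (a 0 i)
  end.

Context (X : completeNormedModType R[i]).

Definition subspace_of_dim n (F : set X) : Prop :=
  exists u : {linear 'rV[R[i]]_n -> X}, injective u /\ range u = F.

Definition finite_dim_subspace (F : set X) : Prop :=
  exists n, subspace_of_dim n F.

(* Banach-Mazur distance between F and l_r^n: the infimum of |u| |u^-1| over
   the linear isomorphisms u from l_r^n onto F. *)
Definition banach_mazur_lr (r : \bar R) n (F : set X) : \bar R :=
  ereal_inf [set
    (ereal_sup [set (rnorm (u a))%:E | a in [set a | (lr_norm r a <= 1)%R]] *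
     ereal_sup [set (lr_norm r a)%:E | a in [set a | (rnorm (u a) <= 1)%R]])%E
  | u in [set u : {linear 'rV[R[i]]_n -> X} | injective u /\ range u = F]].

Definition Lr_space (r : \bar R) : Prop :=
  exists2 lambda : R, 1 < lambda &
  forall E : set X, finite_dim_subspace E ->
  exists n (F : set X),
    [/\ subspace_of_dim n F, E `<=` F & (banach_mazur_lr r n F <= lambda%:E)%E].

End Lr_spaces.

Section ell2_type.
Context {R : realType}.
Implicit Types u v : nat -> R[i].

Definition sqsum u : \bar R := (\sum_(0 <= n <oo) (rnorm (u n) ^+ 2)%:E)%E.

Definition square_summable : {pred nat -> R[i]} :=
  fun u => `[< (sqsum u < +oo)%E >].

Lemma sqsum_ge0 u : (0 <= sqsum u)%E.
Proof. by apply: nneseries_ge0 => n _ _; rewrite lee_fin sqr_ge0. Qed.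

Lemma sqsumZ (c : R[i]) u : sqsum (c *: u) = ((rnorm c ^+ 2)%:E * sqsum u)%E.
Proof.
rewrite /sqsum -nneseriesZl; last by move=> i _; rewrite lee_fin sqr_ge0.
by apply: eq_eseriesr => i _; rewrite -EFinM -exprMn -rnormM.
Qed.

Lemma sqsumD (s t : R) u v : 0 < s -> 0 < t ->
  (sqsum (u + v)%R <= ((s + t) / s)%:E * sqsum u + ((s + t) / t)%:E * sqsum v)%E.
Proof.
move=> s0 t0; have st0 : 0 <= s + t by rewrite addr_ge0// ltW.
rewrite /sqsum -!nneseriesZl; try by move=> i _; rewrite lee_fin sqr_ge0.
rewrite -nneseriesD; try by move=> i _ _; rewrite -EFinM lee_fin
  mulr_ge0// ?sqr_ge0// divr_ge0// ltW.
apply: lee_nneseries => [i _ _|i _]; first by rewrite lee_fin sqr_ge0.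
rewrite -!EFinM -EFinD lee_fin.
set a := rnorm (u i); set b := rnorm (v i).
apply: (@le_trans _ _ ((a + b) ^+ 2)).
  by rewrite lerXn2r ?nnegrE ?addr_ge0 ?rnorm_ge0// ler_rnormD.
rewrite -subr_ge0.
rewrite [leRHS](_ : _ = (a * t - b * s) ^+ 2 / (s * t)); last first.
  by field; rewrite ?lt0r_neq0.
by rewrite divr_ge0 ?sqr_ge0// mulr_ge0// ltW.
Qed.

Lemma square_summable_submod_closed : submod_closed square_summable.
Proof.
split=> [|c u v /asboolP hu /asboolP hv].
  by apply/asboolP; rewrite /sqsum eseries0 ?ltry// => i _ _;
    rewrite rnorm0 expr0n.
apply/asboolP; apply: (le_lt_trans (sqsumD _ _ ltr01 ltr01)).
rewrite lte_add_pinfty// ?sqsumZ ?muleA -?EFinM; apply: lte_mul_pinfty => //.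
by rewrite lee_fin mulr_ge0 ?sqr_ge0// divr_ge0// addr_ge0.
Qed.

HB.instance Definition _ := GRing.isSubmodClosed.Build R[i] (nat -> R[i])
  square_summable square_summable_submod_closed.

Record ell2 := Ell2 {
  ell2_seq :> nat -> R[i];
  ell2_summable : ell2_seq \in square_summable }.

HB.instance Definition _ := [isSub for ell2_seq].
HB.instance Definition _ := [Choice of ell2 by <:].
HB.instance Definition _ := [SubChoice_isSubLmodule of ell2 by <:].

End ell2_type.
Arguments ell2 R : clear implicits.

Section ell2_norm.
Context {R : realType}.
Implicit Types u v : ell2 R.

Definition ell2_norm u : R := Num.sqrt (fine (sqsum u)).

Lemma sqsum_fin u : sqsum u = (ell2_norm u ^+ 2)%:E.
Proof.
have := ell2_summable u => /asboolP ufin.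
rewrite sqr_sqrtr ?fine_ge0 ?sqsum_ge0// fineK//.
by rewrite ge0_fin_numE// sqsum_ge0.
Qed.

Lemma ell2_norm_ge0 u : 0 <= ell2_norm u.
Proof. exact: sqrtr_ge0. Qed.

Lemma ell2_norm0_eq0 u : ell2_norm u = 0 -> u = 0.
Proof.
move=> u0; apply/val_inj/funext => n; apply: rnorm0_eq0; apply/eqP.
rewrite -sqrf_eq0 eq_le sqr_ge0 andbT -lee_fin.
have <- : sqsum u = 0%:E by rewrite sqsum_fin u0 expr0n.
rewrite /sqsum (@nneseriesD1 _ _ n xpredT)//=; last first.
  by move=> k _; rewrite lee_fin sqr_ge0.
by rewrite leeDl// nneseries_ge0// => k _ _; rewrite lee_fin sqr_ge0.
Qed.

Lemma ell2_normZ (c : R[i]) u : ell2_norm (c *: u) = rnorm c * ell2_norm u.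
Proof.
apply/eqP; rewrite -(@eqrXn2 _ 2)// ?ell2_norm_ge0 ?mulr_ge0
  ?rnorm_ge0 ?ell2_norm_ge0// exprMn.
have /eqP := sqsum_fin (c *: u).
by rewrite sqsumZ sqsum_fin -EFinM eqe eq_sym.
Qed.

Lemma ler_ell2_normD u v : ell2_norm (u + v) <= ell2_norm u + ell2_norm v.
Proof.
have [/ell2_norm0_eq0 ->|u0] := eqVneq (ell2_norm u) 0.
  by rewrite add0r lerDr ell2_norm_ge0.
have [/ell2_norm0_eq0 ->|v0] := eqVneq (ell2_norm v) 0.
  by rewrite addr0 lerDl ell2_norm_ge0.
have {}u0 : 0 < ell2_norm u by rewrite lt_def u0 ell2_norm_ge0.
have {}v0 : 0 < ell2_norm v by rewrite lt_def v0 ell2_norm_ge0.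
rewrite -(@ler_pXn2r _ 2)// ?nnegrE ?addr_ge0 ?ell2_norm_ge0//.
have := sqsumD u v u0 v0.
rewrite -[(u : nat -> _) + v]/((u + v : ell2 R) : nat -> R[i]) !sqsum_fin.
rewrite -!EFinM -EFinD lee_fin => /le_trans; apply.
rewrite le_eqVlt; apply/orP; left; apply/eqP.
by field; rewrite ?lt0r_neq0.
Qed.

Let norm u : R[i] := (ell2_norm u)%:C.

Let ler_normD u v : norm (u + v) <= norm u + norm v.
Proof. by rewrite /norm -rmorphD/= lecR ler_ell2_normD. Qed.

Let normrZ (c : R[i]) u : norm (c *: u) = `|c| * norm u.
Proof. by rewrite /norm ell2_normZ rmorphM/= rnormE. Qed.

Let normr0_eq0 u : norm u = 0 -> u = 0.
Proof. by move=> /complexI /ell2_norm0_eq0. Qed.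

HB.instance Definition _ := Lmodule_isNormed.Build R[i] (ell2 R)
  ler_normD normrZ normr0_eq0.

Definition ell2_dot u v : R[i] :=
  lim (series (fun n => u n * (v n)^* : R[i]^o) @ \oo).

Definition orthonormal_seq (e : nat -> ell2 R) : Prop :=
  forall i j, ell2_dot (e i) (e j) = (i == j)%:R.

End ell2_norm.

Section schatten.
Context {R : realType}.

Definition operator_norm (A : ell2 R -> ell2 R) : \bar R :=
  ereal_sup [set (rnorm (A u))%:E | u in [set u | rnorm u <= 1]].

Definition compact_operator (A : ell2 R -> ell2 R) : Prop :=
  linear A /\ compact (closure (A @` [set u | rnorm u <= 1])).

(* A = sum_n s_n <., e_n> f_n with (e_n), (f_n) orthonormal: s is a sequence of
   singular numbers of A, in no particular order.  As l_2 is infinite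
   dimensional, a compact operator always has such a representation indexed by
   the whole of nat, with s padded by zeros if A has finite rank. *)
Definition schmidt_representation (A : ell2 R -> ell2 R) (s : nat -> R) : Prop :=
  (forall n, 0 <= s n) /\
  exists e f : nat -> ell2 R,
    [/\ orthonormal_seq e, orthonormal_seq f &
     forall u, series (fun n => ((s n)%:C * ell2_dot u (e n)) *: f n) @ \oo
               --> A u].

Definition lr_seq_norm (r : R) (s : nat -> R) : \bar R :=
  ((\sum_(0 <= n <oo) (s n `^ r)%:E) `^ r^-1)%E.

(* schatten r A c : A belongs to S_r and its norm in S_r is c. *)
Definition schatten (r : \bar R) (A : ell2 R -> ell2 R) (c : R) : Prop :=
  match r with
  | r'%:E => compact_operator A /\
      exists2 s, schmidt_representation A s & lr_seq_norm r' s = c%:E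
  | _ => compact_operator A /\ operator_norm A = c%:E
  end.

(* X is the Banach space S_r, up to an isometric linear isomorphism J. *)
Definition is_schatten_class (r : \bar R) (X : completeNormedModType R[i]) :
    Prop :=
  exists J : {linear X -> (ell2 R -> ell2 R)},
    (forall x, schatten r (J x) (rnorm x)) /\
    (forall A c, schatten r A c -> exists x, J x = A).

End schatten.

(* Main.v *)
Require Import Defs.
From HB Require Import structures.
From mathcomp Require Import all_boot all_order all_algebra complex ring lra.
From mathcomp Require Import all_classical all_reals all_analysis.
From mathcomp Require Import measurable_realfun sesquilinear spectral.

(* For f = sum_a x_a z^a homogeneous of degree m, all estimates rest on
   orthogonality of the characters of the torus.  Scalar polynomials satisfy
   |f|_4^4 <= 4^m |f|_2^4, since a multi-index of degree 2m has at most 4^m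
   decompositions into two summands of degree m; hence |f|_2 <= 2^m |f|_1.

   In l_r^n with r <= q, Minkowski's inequality bounds the l_q norm of
   (|x_a|)_a by the l_r norm of the square function (sum_a |x_a|^2)^(1/2), whose
   coordinates are L^2 norms of scalar polynomials, hence at most 2^m times
   their L^1 norms; Minkowski's inequality for the integral concludes.  If X has
   cotype q < r, testing cotype on images of unit vectors bounds the dimension
   of the copies of l_r^n in X, and the estimate is made coordinatewise.

   In S_r, 2 <= r <= q, let x_a have singular numbers s_{a,n} and right singular
   vectors e_{a,n}.  Diagonalizing the Gram matrix of the vectors
   s_{a,n} e_{a,n} gives orthonormal b_k with
     sum |x_a|_r^r <= sum_k (sum_a |x_a b_k|^2)^(r/2)
                    = sum_k (int |f b_k|^2)^(r/2) <= (int |f|_r^2)^(r/2),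
   by Parseval, Minkowski and sum_k |A b_k|^r <= |A|_r^r.  Cotype q of S_r forces
   r <= q, by testing it on the diagonal matrix units. *)

Set Implicit Arguments.
Unset Strict Implicit.
Unset Printing Implicit Defensive.

Import Order.TTheory GRing.Theory Num.Theory.
Import numFieldNormedType.Exports.

Local Open Scope classical_set_scope.
Local Open Scope ring_scope.
Local Open Scope complex_scope.

(** * Inequalities in finite-dimensional l_p *)

Section powR_inequalities.
Context {R : realType}.
Implicit Types (p q x y a : R).

Lemma powR_tangent p y a : 1 <= p -> 0 <= y -> 0 <= a ->
  a `^ p + p * a `^ (p - 1) * (y - a) <= y `^ p.
Proof.
move=> p1 y0 a0; have p0 : 0 < p by apply: lt_le_trans p1.
have apE : a `^ (p - 1) * a = a `^ p by rewrite mulrC mulr_powRB1.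
(* The conjugate exponent p / (p - 1) degenerates at p = 1, where the bound is an equality.
   Otherwise it is Young's inequality for y and a ^ (p - 1). *)
have [->|pn1] := eqVneq p 1.
  by rewrite subrr powRr0 !mul1r !powRr1//; lra.
have {pn1}p1' : 0 < p - 1 by rewrite subr_gt0 lt_neqAle eq_sym pn1.
have := @conjugate_powR _ y (a `^ (p - 1)) p (p / (p - 1)) y0 (powR_ge0 _ _) p0.
rewrite divr_gt0// => /(_ isT).
have -> : p^-1 + (p / (p - 1))^-1 = 1 by rewrite invf_div; field; rewrite gt_eqF.
move=> /(_ erefl).
rewrite -powRrM (_ : (p - 1) * (p / (p - 1)) = p); last by field; rewrite gt_eqF.
rewrite -(ler_pM2l p0) [leRHS](_ : _ = y `^ p + (p - 1) * a `^ p); last first.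
  by rewrite invf_div; field; rewrite gt_eqF.
rewrite mulrBr -[p * _ * a]mulrA apE [y * _]mulrC mulrA; lra.
Qed.

Lemma powR_invK p x : 0 < p -> 0 <= x -> (x `^ p) `^ p^-1 = x.
Proof. by move=> p0 x0; rewrite -powRrM divff ?gt_eqF// powRr1. Qed.

Lemma powRVK p x : 0 < p -> 0 <= x -> (x `^ p^-1) `^ p = x.
Proof. by move=> p0 x0; rewrite -powRrM mulVf ?gt_eqF// powRr1. Qed.

Lemma ler_powR2 p x y : 0 <= p -> 0 <= x -> x <= y -> x `^ p <= y `^ p.
Proof.
by move=> p0 x0 xy; apply: ge0_ler_powR => //; rewrite nnegrE// (le_trans x0).
Qed.

Lemma ler_powR_inv p x y : 0 < p -> 0 <= x -> 0 <= y ->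
  x `^ p <= y -> x <= y `^ p^-1.
Proof.
move=> p0 x0 y0 xy; rewrite -(powR_invK p0 x0); apply: ler_powR2 => //.
  by rewrite invr_ge0 ltW.
exact: powR_ge0.
Qed.

Lemma ler_powRV p x y : 0 < p -> 0 <= x -> 0 <= y ->
  x <= y `^ p -> x `^ p^-1 <= y.
Proof.
move=> p0 x0 y0 xy; rewrite -(powR_invK p0 y0); apply: ler_powR2 => //.
by rewrite invr_ge0 ltW.
Qed.

Lemma powR_subK p q x : 0 < p -> p <= q -> x `^ q = x `^ (q - p) * x `^ p.
Proof.
move=> p0 pq; have [->|x0] := eqVneq x 0.
  by rewrite (@powR0 _ p) ?gt_eqF// mulr0 powR0// gt_eqF// (lt_le_trans p0).
by rewrite -powRD ?subrK// x0 implybT.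
Qed.

End powR_inequalities.

Section finite_lp.
Context {R : realType} {I : finType} (P : pred I).
Implicit Types (p q : R) (w y g : I -> R).

(** The l_p norm over the indices satisfying [P]. No absolute value is taken: it is applied to
    nonnegative families, mostly families of norms. *)
Definition lp p y : R := (\sum_(i | P i) y i `^ p) `^ p^-1.

Lemma sum_powR_ge0 p y : 0 <= \sum_(i | P i) y i `^ p.
Proof. by apply: sumr_ge0 => i _; exact: powR_ge0. Qed.

Lemma lp_ge0 p y : 0 <= lp p y.
Proof. exact: powR_ge0. Qed.

Lemma lp_powR p y : 0 < p -> lp p y `^ p = \sum_(i | P i) y i `^ p.
Proof. by move=> p0; rewrite /lp powRVK// sum_powR_ge0. Qed.

Lemma le_lp_coord p y i : 0 < p -> P i -> 0 <= y i -> y i <= lp p y.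
Proof.
move=> p0 Pi yi; apply: ler_powR_inv => //; first exact: sum_powR_ge0.
by rewrite (bigD1 i)//= lerDl sumr_ge0// => j _; exact: powR_ge0.
Qed.

Lemma ler_lp p y g : 0 < p -> (forall i, P i -> 0 <= y i <= g i) ->
  lp p y <= lp p g.
Proof.
move=> p0 yg; apply: ler_powR2; first by rewrite invr_ge0 ltW.
  exact: sum_powR_ge0.
apply: ler_sum => i /yg /andP[y0 yg'].
by apply: ler_powR2 => //; rewrite ltW.
Qed.

Lemma lpZ p (c : R) y : 0 < p -> 0 <= c -> (forall i, P i -> 0 <= y i) ->
  lp p (fun i => c * y i) = c * lp p y.
Proof.
move=> p0 c0 y0; rewrite /lp (eq_bigr (fun i => c `^ p * y i `^ p)); last first.
  by move=> i Pi; rewrite powRM// y0.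
by rewrite -mulr_sumr powRM ?powR_ge0 ?sum_powR_ge0// powR_invK.
Qed.

(** Average the tangent inequality at the weighted mean [a]. If the weights have total mass [W], the
    average exceeds a ^ p by a ^ p (p - 1) (1 - W), which is nonnegative, so sub-probability weights
    are allowed. *)
Lemma jensen_powR p w y : 1 <= p -> (forall i, P i -> 0 <= w i) ->
  \sum_(i | P i) w i <= 1 -> (forall i, P i -> 0 <= y i) ->
  (\sum_(i | P i) w i * y i) `^ p <= \sum_(i | P i) w i * y i `^ p.
Proof.
move=> p1 w0 w1 y0; set a := \sum_(i | P i) w i * y i.
have p0 : 0 < p by apply: lt_le_trans p1.
have a0 : 0 <= a by apply: sumr_ge0 => i Pi; rewrite mulr_ge0 ?w0 ?y0.
apply: (@le_trans _ _
    (\sum_(i | P i) w i * (a `^ p + p * a `^ (p - 1) * (y i - a)))); last first.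
  by apply: ler_sum => i Pi; rewrite ler_wpM2l ?w0// powR_tangent ?y0.
set W := \sum_(i | P i) w i in w1 *.
rewrite (eq_bigr (fun i => w i * (a `^ p - p * a `^ (p - 1) * a)
    + (p * a `^ (p - 1)) * (w i * y i))); last by move=> i _; ring.
rewrite big_split/= -mulr_suml -mulr_sumr -/W -/a.
have apE : p * a `^ (p - 1) * a = p * a `^ p by rewrite -mulrA [_ * a]mulrC mulr_powRB1.
rewrite apE.
have ap0 := powR_ge0 a p; rewrite -subr_ge0.
rewrite [X in 0 <= X](_ : _ = a `^ p * ((p - 1) * (1 - W))); last by ring.
by rewrite mulr_ge0// mulr_ge0// subr_ge0.
Qed.

(** The equality case of Young's inequality in disguise: summing the tangent inequality at
    [G i / S], evaluated at [g i / n], gives 1 + p (D - 1) <= 1, where D is the left side divided by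
    [n]. *)
Lemma sum_conjugate_le p G g (S n : R) : 1 <= p -> 0 < S -> 0 < n ->
  (forall i, P i -> 0 <= G i) -> (forall i, P i -> 0 <= g i) ->
  \sum_(i | P i) (G i / S) `^ p = 1 -> \sum_(i | P i) (g i / n) `^ p = 1 ->
  \sum_(i | P i) (G i / S) `^ (p - 1) * g i <= n.
Proof.
move=> p1 S0 n0 G0 g0 GS1 gn1; have p0 : 0 < p by apply: lt_le_trans p1.
rewrite -[leRHS]mul1r -ler_pdivrMr// mulr_suml; set D := \sum_(i | P i) _.
suff : 1 + p * (D - 1) <= 1 by rewrite gerDl pmulr_rle0// subr_le0.
have GS1' : \sum_(i | P i) (G i / S) `^ (p - 1) * (G i / S) = 1.
  rewrite -[RHS]GS1; apply: eq_bigr => i Pi.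
  rewrite -(@mulr_powRB1 _ (G i / S) p)//; first by rewrite [LHS]mulrC.
  exact: divr_ge0 (G0 _ Pi) (ltW S0).
have -> : 1 + p * (D - 1) = \sum_(i | P i)
    ((G i / S) `^ p + p * (G i / S) `^ (p - 1) * (g i / n - G i / S)).
  rewrite big_split/= GS1; congr (_ + _).
  by rewrite /D -[X in _ - X]GS1' -sumrB mulr_sumr; apply: eq_bigr => i _; ring.
rewrite -[leRHS]gn1; apply: ler_sum => i Pi; apply: powR_tangent => //.
  exact: divr_ge0 (g0 _ Pi) (ltW n0).
exact: divr_ge0 (G0 _ Pi) (ltW S0).
Qed.

(* The norming functional of G in the dual of l_p, equal to
   (G / |G|_p) ^ (p - 1); that its norm is at most 1 is the tangent inequality
   summed over i. *)
Lemma lp_norming p G : 1 <= p -> (forall i, P i -> 0 <= G i) ->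
  exists c : I -> R, [/\ forall i, 0 <= c i, \sum_(i | P i) c i * G i = lp p G &
    forall g, (forall i, P i -> 0 <= g i) -> \sum_(i | P i) c i * g i <= lp p g].
Proof.
move=> p1 G0; have p0 : 0 < p by apply: lt_le_trans p1.
have [S0|S0] := eqVneq (lp p G) 0.
  exists (fun=> 0); split => //.
    by rewrite S0 big1// => i _; rewrite mul0r.
  by move=> g _; rewrite big1 ?lp_ge0// => i _; rewrite mul0r.
have {}S0 : 0 < lp p G by rewrite lt_def S0 lp_ge0.
set S := lp p G in S0 *.
have unit_sum g : (forall i, P i -> 0 <= g i) -> 0 < lp p g ->
    \sum_(i | P i) (g i / lp p g) `^ p = 1.
  move=> g0 n0; rewrite (eq_bigr (fun i => g i `^ p * (lp p g)^-1 `^ p)).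
    rewrite -mulr_suml -lp_powR// -powRM ?invr_ge0 ?lp_ge0//.
    by rewrite divff ?powR1// gt_eqF.
  by move=> i Pi; rewrite powRM ?g0// invr_ge0 lp_ge0.
have SS : \sum_(i | P i) (G i / S) `^ (p - 1) * G i = S.
  rewrite (eq_bigr (fun i => S * (G i / S) `^ p)).
    by rewrite -mulr_sumr unit_sum// mulr1.
  move=> i Pi; rewrite -(@mulr_powRB1 _ (G i / S) p)//; last first.
    exact: divr_ge0 (G0 _ Pi) (ltW S0).
  by field; rewrite gt_eqF.
exists (fun i => (G i / S) `^ (p - 1)); split; [by move=> i; exact: powR_ge0|exact: SS|].
move=> g g0; have [n0|n0] := eqVneq (lp p g) 0.
  rewrite n0 big1// => i Pi.
  have := le_lp_coord p0 Pi (g0 _ Pi); rewrite n0 => gi.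
  by rewrite (_ : g i = 0) ?mulr0//; apply/eqP; rewrite eq_le gi g0.
have {}n0 : 0 < lp p g by rewrite lt_def n0 lp_ge0.
exact: (sum_conjugate_le p1 S0 n0 G0 g0 (unit_sum _ G0 S0) (unit_sum _ g0 n0)).
Qed.

(** Each coordinate is at most the l_p norm, so y_i ^ q is at most that norm to the power q - p,
    times y_i ^ p. *)
Lemma lp_le_lp p q y : 0 < p -> p <= q -> (forall i, P i -> 0 <= y i) ->
  lp q y <= lp p y.
Proof.
move=> p0 pq y0; have q0 : 0 < q by apply: lt_le_trans pq.
apply: ler_powRV; rewrite ?lp_ge0 ?sum_powR_ge0//.
rewrite (powR_subK _ p0 pq) lp_powR// mulr_sumr; apply: ler_sum => i Pi.
rewrite (powR_subK _ p0 pq) ler_wpM2r ?powR_ge0//.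
apply: ler_powR2; [by rewrite subr_ge0|exact: y0|].
by apply: le_lp_coord => //; exact: y0.
Qed.

End finite_lp.

(** Minkowski's inequality: the norming functional of the sum is tested on each summand. *)
Lemma lp_sum_le (R : realType) (I K : finType) (P : pred I) (p : R) (y : I -> K -> R) :
  1 <= p -> (forall i k, 0 <= y i k) ->
  lp P p (fun i => \sum_k y i k) <= \sum_k lp P p (y^~ k).
Proof.
move=> p1 y0.
have [|c [c0 <- cle]] := @lp_norming R I P p (fun i => \sum_k y i k) p1.
  by move=> i _; exact: sumr_ge0.
under eq_bigr do rewrite mulr_sumr.
by rewrite exchange_big/=; apply: ler_sum => k _; exact: cle.
Qed.

(** * Integrals of bounded measurable functions *)

Section bounded_measurable.
Context d (T : measurableType d) {R : realType} (P : probability T R).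
Implicit Types f g : T -> R.

(** This class is stable under sums and products, and its members are integrable against every
    probability, which settles all integrability conditions at once. *)
Definition bounded_mfun f :=
  measurable_fun setT f /\ exists M, forall t, `|f t| <= M.

Lemma bounded_mfun_cst (c : R) : bounded_mfun (fun=> c).
Proof. by split; [exact: measurable_cst | exists `|c|]. Qed.

Lemma bounded_mfunD f g : bounded_mfun f -> bounded_mfun g ->
  bounded_mfun (fun t => f t + g t).
Proof.
move=> [mf [M fM]] [mg [N gN]]; split; first exact: measurable_funD.
by exists (M + N) => t; rewrite (le_trans (ler_normD _ _))// lerD.
Qed.

Lemma bounded_mfunM f g : bounded_mfun f -> bounded_mfun g ->
  bounded_mfun (fun t => f t * g t).
Proof.
move=> [mf [M fM]] [mg [N gN]]; split; first exact: measurable_funM.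
by exists (M * N) => t; rewrite normrM ler_pM.
Qed.

Lemma bounded_mfun_sum I (s : seq I) (Q : pred I) (F : I -> T -> R) :
  (forall i, bounded_mfun (F i)) ->
  bounded_mfun (fun t => \sum_(i <- s | Q i) F i t).
Proof.
move=> bF; elim: s => [|i s IH].
  by under [X in bounded_mfun X]eq_fun do rewrite big_nil; exact: bounded_mfun_cst.
under [X in bounded_mfun X]eq_fun do rewrite big_cons.
by case: (Q i) => //; exact: bounded_mfunD.
Qed.

Lemma bounded_mfunX f k : bounded_mfun f -> bounded_mfun (fun t => f t ^+ k).
Proof.
move=> bf; elim: k => [|k IH].
  by under [X in bounded_mfun X]eq_fun do rewrite expr0; exact: bounded_mfun_cst.
by under [X in bounded_mfun X]eq_fun do rewrite exprS; exact: bounded_mfunM.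
Qed.

Lemma bounded_mfun_integrable f : bounded_mfun f ->
  P.-integrable setT (EFin \o f).
Proof.
move=> [mf [M fM]].
apply: (@le_integrable _ _ _ _ setT measurableT _ (EFin \o cst M)) => //.
- exact/measurable_EFinP.
- move=> t _ /=; rewrite lee_fin; apply: le_trans (fM t) _.
  exact: ler_norm.
- exact: finite_measure_integrable_cst.
Qed.

Local Notation E f := (\int[P]_t f t).

Lemma Rint_cst (c : R) : E (fun=> c) = c.
Proof.
rewrite Rintegral_cst//.
by rewrite [X in fine X](@probability_setT _ _ _ P) mulr1.
Qed.

Lemma RintD f g : bounded_mfun f -> bounded_mfun g ->
  E (fun t => f t + g t) = E f + E g.
Proof. by move=> bf bg; rewrite RintegralD//; exact: bounded_mfun_integrable. Qed.

Lemma RintZ (c : R) f : bounded_mfun f -> E (fun t => c * f t) = c * E f.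
Proof. by move=> bf; rewrite RintegralZl//; exact: bounded_mfun_integrable. Qed.

Lemma Rint_sum I (s : seq I) (Q : pred I) (F : I -> T -> R) :
  (forall i, bounded_mfun (F i)) ->
  E (fun t => \sum_(i <- s | Q i) F i t) = \sum_(i <- s | Q i) E (F i).
Proof.
move=> bF; elim: s => [|i s IH].
  by under eq_Rintegral do rewrite big_nil; rewrite Rint_cst big_nil.
under eq_Rintegral do rewrite big_cons.
rewrite big_cons; case: (Q i) => //.
by rewrite RintD ?IH//; exact: bounded_mfun_sum.
Qed.

Lemma le_Rint f g : bounded_mfun f -> bounded_mfun g ->
  (forall t, f t <= g t) -> E f <= E g.
Proof.
by move=> bf bg fg; apply: le_Rintegral => //; exact: bounded_mfun_integrable.
Qed.

Lemma Rint_ge0 f : (forall t, 0 <= f t) -> 0 <= E f.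
Proof. by move=> f0; exact: Rintegral_ge0. Qed.

(** Integrate f ^ 2 >= 2 a f - a ^ 2 with a the mean of f. *)
Lemma Rint_sqr_le f : bounded_mfun f -> (E f) ^+ 2 <= E (fun t => f t ^+ 2).
Proof.
move=> bf; set a := E f.
have : E (fun t => - a ^+ 2 + (a *+ 2) * f t) <= E (fun t => f t ^+ 2).
  apply: le_Rint; last by move=> t; have := sqr_ge0 (f t - a); nra.
    by apply: bounded_mfunD (bounded_mfun_cst _) _; apply: bounded_mfunM bf; exact: bounded_mfun_cst.
  exact: bounded_mfunX.
rewrite RintD ?RintZ ?Rint_cst//; first by rewrite -/a; nra.
  exact: bounded_mfun_cst.
by apply: bounded_mfunM bf; exact: bounded_mfun_cst.
Qed.

(** Minkowski's integral inequality: the norming functional of the vector of integrals commutes with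
    the integral and is bounded pointwise by the l_p norm. The majorant [n] takes the place of that
    norm, so only [n] has to be measurable. *)
Lemma lp_Rint_le (I : finType) (p : R) (g : I -> T -> R) (n : T -> R) :
  1 <= p -> (forall i, bounded_mfun (g i)) -> (forall i t, 0 <= g i t) ->
  bounded_mfun n -> (forall t, lp xpredT p (g^~ t) <= n t) ->
  lp xpredT p (fun i => E (g i)) <= E n.
Proof.
move=> p1 bg g0 bn gn.
have [|c [c0 <- cle]] := @lp_norming R I xpredT p (fun i => E (g i)) p1.
  by move=> i _; exact: Rint_ge0.
under eq_bigr do rewrite -RintZ//.
have bcg i : bounded_mfun (fun t => c i * g i t).
  exact: bounded_mfunM (bounded_mfun_cst _) _.
rewrite -Rint_sum//; apply: le_Rint => //; first exact: bounded_mfun_sum.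
by move=> t; apply: le_trans (gn t); apply: cle.
Qed.

(* AM-GM gives x ^ 4 + 2 l ^ 3 x >= 3 l ^ 2 x ^ 2; take l = k * sqrt (E[f ^ 2]). *)
Lemma Rint_L2_le_L1 f (k : R) : bounded_mfun f -> (forall t, 0 <= f t) ->
  0 < k -> E (fun t => f t ^+ 4) <= k ^+ 2 * (E (fun t => f t ^+ 2)) ^+ 2 ->
  Num.sqrt (E (fun t => f t ^+ 2)) <= k * E f.
Proof.
move=> bf f0 k0; set A := E (fun t => f t ^+ 2) => H4.
have A0 : 0 <= A by apply: Rint_ge0 => t; exact: sqr_ge0.
have Ef0 : 0 <= E f by exact: Rint_ge0.
set s := Num.sqrt A; have s2 : s ^+ 2 = A by rewrite sqr_sqrtr.
have s0 : 0 <= s by exact: sqrtr_ge0.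
pose l := k * s; have l0 : 0 <= l by rewrite mulr_ge0// ltW.
have : E (fun t => (3 * l ^+ 2) * f t ^+ 2) <=
       E (fun t => f t ^+ 4 + (2 * l ^+ 3) * f t).
  apply: le_Rint => [||t].
  - by apply: bounded_mfunM (bounded_mfun_cst _) _; exact: bounded_mfunX.
  - apply: bounded_mfunD; first exact: bounded_mfunX.
    exact: bounded_mfunM (bounded_mfun_cst _) _.
  - rewrite -subr_ge0 (_ : _ - _ =
      f t * ((f t - l) ^+ 2 * (f t + 2 * l))); last by ring.
    apply: mulr_ge0 => //; apply: mulr_ge0; first exact: sqr_ge0.
    by rewrite addr_ge0// mulr_ge0.
rewrite RintD; last 2 first.
- exact: bounded_mfunX.
- exact: bounded_mfunM (bounded_mfun_cst _) _.
rewrite !RintZ//; last exact: bounded_mfunX.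
rewrite -/A => H; have {H H4} : 3 * l ^+ 2 * A <= k ^+ 2 * A ^+ 2 + 2 * l ^+ 3 * E f.
  by apply: le_trans H _; rewrite lerD2r.
rewrite -s2 /l.
have [->|sn0] := eqVneq s 0; first by rewrite mulr_ge0// ltW.
have {sn0}s0' : 0 < s by rewrite lt_def sn0.
rewrite -subr_ge0 (_ : _ - _ = (2 * k ^+ 2 * s ^+ 3) * (k * E f - s)); last by ring.
by rewrite pmulr_rge0 ?subr_ge0// !mulr_gt0// exprn_gt0.
Qed.
End bounded_measurable.

(** * Characters of the torus *)

Section torus_characters.
Context {R : realType}.
Local Notation T := (measurableTypeR R).

Lemma sinD2pi_int (k : int) (x : R) : sin (x + k%:~R * (pi *+ 2)) = sin x.
Proof.
case: k => n; first by rewrite -[n%:~R]/(n%:R) mulr_natl (periodicn (@sinD2pi R)).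
rewrite NegzE mulrNz mulNr -[n.+1%:~R]/(n.+1%:R) mulr_natl.
by rewrite -[in RHS](subrK (pi *+ 2 *+ n.+1) x) (periodicn (@sinD2pi R)).
Qed.

Lemma measurable_cos_affine (phi : R) n (kappa : 'I_n -> int) :
  measurable_fun setT (fun t : n.-tuple T =>
    cos (phi + \sum_(i < n) (kappa i)%:~R * tnth t i)).
Proof.
apply: (measurableT_comp (f := cos)).
  by apply: continuous_measurable_fun; exact: continuous_cos.
apply: measurable_funD => //; apply: measurable_sum => i.
by apply: measurable_funM => //; exact: measurable_tnth.
Qed.

(** Adding 1 makes the integrand nonnegative, as the density formula for the uniform law and
    Tonelli's theorem require. *)
Lemma uniform_cos (phi : R) (k : int) :
  (\int[uniform_prob (@twopi_gt0 R)]_t (1 + cos (phi + k%:~R * t))%:E =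
   (1 + (k == 0)%:R * cos phi)%:E)%E.
Proof.
have mc : measurable_fun setT (fun t : R => 1 + cos (phi + k%:~R * t)).
  apply: measurable_funD => //; apply: (measurableT_comp (f := cos)).
    by apply: continuous_measurable_fun; exact: continuous_cos.
  apply: measurable_funD => //; exact: measurable_funM.
have [->|k0] := eqVneq k 0.
  under eq_integral do rewrite mul0r addr0.
  rewrite integral_cst// [X in (_ * X)%E](@probability_setT _ _ _ (uniform_prob _)).
  by rewrite mule1 mul1r.
rewrite integral_uniform; last 2 first.
- exact/measurable_EFinP.
- by move=> x; rewrite lee_fin -lerBlDl sub0r cos_geN1.
have kR : k%:~R != 0 :> R by rewrite intr_eq0.
(* An antiderivative whose sine term takes the same value at 0 and at 2 pi. *)
pose F (t : R) : R := t + k%:~R^-1 * sin (phi + k%:~R * t).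
have dF (x : R) : is_derive x 1 F (1 + cos (phi + k%:~R * x)).
  apply: is_derive_eq.
  rewrite /GRing.scale/= !add0r; by field.
have cF : continuous F.
  move=> x; apply: differentiable_continuous; apply/derivable1_diffP.
  by case: (dF x).
rewrite (@continuous_FTC2 _ (fun t => 1 + cos (phi + k%:~R * t)) F)//; last 3 first.
- apply: continuous_subspaceT => x.
  apply: cvgD; first exact: cvg_cst.
  apply: continuous_comp; last exact: continuous_cos.
  apply: cvgD; first exact: cvg_cst.
  by apply: cvgM; [exact: cvg_cst|exact: cvg_id].
- split; first by move=> x _; case: (dF x).
    exact/cvg_at_right_filter/cF.
  exact/cvg_at_left_filter/cF.
- by move=> x _; rewrite derive1E; by case: (dF x).
- rewrite /F sinD2pi_int mulr0 addr0 add0r -EFinB -EFinM subr0 mul0r addr0.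
  by rewrite addrK mulVf// gt_eqF//; exact: twopi_gt0.
exact: twopi_gt0.
Qed.

(** Induction on the number of variables: the inner integral is over all coordinates but the first,
    whose term is absorbed into the phase. This is why [phi] is arbitrary. *)
Lemma torus_cosD1 n (phi : R) (kappa : 'I_n -> int) :
  (\int[torus_prob n]_t (1 + cos (phi + \sum_(i < n) (kappa i)%:~R * tnth t i))%:E
   = (1 + [forall i, kappa i == 0]%:R * cos phi)%:E)%E.
Proof.
elim: n phi kappa => [|n IH] phi kappa /=.
  rewrite integral_dirac//; last first.
    by apply/measurable_EFinP; apply: measurable_funD => //; exact: measurable_cos_affine.
  rewrite diracT mul1e big_ord0 addr0.
  rewrite (_ : [forall i, kappa i == 0]) ?mul1r//.
  by apply/forallP => -[].
rewrite ge0_integral_distribution; last 2 first.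
- by apply/measurable_EFinP; apply: measurable_funD => //; exact: measurable_cos_affine.
- by move=> x; rewrite lee_fin -lerBlDl sub0r cos_geN1.
have mcons := @measurable_tuple_cons R n.
rewrite fubini_tonelli1; last 2 first.
- apply: measurableT_comp => //.
  by apply/measurable_EFinP; apply: measurable_funD => //; exact: measurable_cos_affine.
- by move=> x; rewrite lee_fin -lerBlDl sub0r cos_geN1.
pose k' i := kappa (lift ord0 i).
transitivity (\int[uniform_prob (@twopi_gt0 R)]_x
   (1 + [forall i, k' i == 0]%:R * cos (phi + (kappa ord0)%:~R * x))%:E)%E.
  apply: eq_integral => x _; rewrite -IH; apply: eq_integral => t _ /=.
  rewrite big_ord_recl -addrA/=; congr ((1 + cos _)%:E); congr (_ + (_ + _)).
  by apply: eq_bigr => i _; rewrite /tuple_cons/= tnthS.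
rewrite (_ : [forall i, kappa i == 0] = (kappa ord0 == 0) && [forall i, k' i == 0]); last first.
  apply/forallP/andP => [k0|[k00 /forallP k0] i].
    by split=> //; apply/forallP => i; exact: k0.
  by case: (unliftP ord0 i) => [j|] -> //; exact: k0.
case: [forall i, k' i == 0]; rewrite ?andbT ?andbF/=.
  by under eq_integral do rewrite mul1r; rewrite uniform_cos.
under eq_integral do rewrite mul0r addr0.
rewrite integral_cst// [X in (_ * X)%E](@probability_setT _ _ _ (uniform_prob _)).
by rewrite mule1 mul0r addr0.
Qed.

Lemma bounded_mfun_cos n (phi : R) (kappa : 'I_n -> int) :
  bounded_mfun (fun t : n.-tuple T =>
    cos (phi + \sum_(i < n) (kappa i)%:~R * tnth t i)).
Proof.
split; first exact: measurable_cos_affine.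
by exists 1 => t; exact: cos_max.
Qed.

Lemma Rint_torus_cos n (phi : R) (kappa : 'I_n -> int) :
  \int[torus_prob n]_t cos (phi + \sum_(i < n) (kappa i)%:~R * tnth t i)
  = [forall i, kappa i == 0]%:R * cos phi.
Proof.
apply: (addrI 1); rewrite -[X in X + _ = _](Rint_cst (torus_prob n)).
rewrite -RintD; [|exact: bounded_mfun_cst|exact: bounded_mfun_cos].
by rewrite /Rintegral torus_cosD1.
Qed.

(** The sine is written as a cosine with phase - pi / 2, so that [Rint_torus_cos] covers both
    terms. *)
Lemma ReM_expi (c : R[i]) (s : R) :
  complex.Re (c * expi s) =
  complex.Re c * cos (0 + s) - complex.Im c * cos (- (pi / 2) + s).
Proof. by case: c => a b; rewrite add0r [- (pi / 2) + s]addrC cosBpihalf. Qed.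

Lemma bounded_mfun_Re_expi n (c : R[i]) (kappa : 'I_n -> int) :
  bounded_mfun (fun t : n.-tuple T =>
    complex.Re (c * expi (\sum_(i < n) (kappa i)%:~R * tnth t i))).
Proof.
under [X in bounded_mfun X]eq_fun do rewrite ReM_expi -mulNr.
by apply: bounded_mfunD; apply: bounded_mfunM; (exact: bounded_mfun_cst || exact: bounded_mfun_cos).
Qed.

Lemma Rint_torus_Re_expi n (c : R[i]) (kappa : 'I_n -> int) :
  \int[torus_prob n]_t complex.Re (c * expi (\sum_(i < n) (kappa i)%:~R * tnth t i))
  = [forall i, kappa i == 0]%:R * complex.Re c.
Proof.
under eq_Rintegral do rewrite ReM_expi -mulNr.
rewrite RintD ?RintZ ?Rint_torus_cos; try exact: bounded_mfun_cos; try by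
  apply: bounded_mfunM; (exact: bounded_mfun_cst || exact: bounded_mfun_cos).
by rewrite cosN cos_pihalf cos0 mulr1 mulr0 mulr0 addr0 mulrC.
Qed.

End torus_characters.

Section complex_parts.
Context {R : realType}.
Implicit Types (z w : R[i]) (s t : R).

Lemma ReD z w : complex.Re (z + w) = complex.Re z + complex.Re w.
Proof. by case: z w => [a b] [c d]. Qed.

Lemma Re_sum I (r : seq I) (Q : pred I) (F : I -> R[i]) :
  complex.Re (\sum_(i <- r | Q i) F i) = \sum_(i <- r | Q i) complex.Re (F i).
Proof. exact: (big_morph (@complex.Re R) ReD). Qed.

Lemma conjcE z : z^*%R = conjc z.
Proof. by []. Qed.

Lemma sqr_rnormE z : rnorm z ^+ 2 = complex.Re (z * z^*%R).
Proof.
by apply: complexI; rewrite rmorphXn/= rnormE normCK RRe_real// -normCK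
  realX// normr_real.
Qed.

Lemma sqr_rnorm z : rnorm z ^+ 2 = complex.Re z ^+ 2 + complex.Im z ^+ 2.
Proof. by rewrite sqr_rnormE conjcE; case: z => a b /=; rewrite mulrN opprK -!expr2. Qed.

Lemma Re_le_rnorm z : complex.Re z <= rnorm z.
Proof.
apply: le_trans (ler_norm _) _.
by rewrite -lecR rnormE normc_ge_Re.
Qed.

Lemma rnormJ z : rnorm z^*%R = rnorm z.
Proof. by rewrite /rnorm norm_conjC. Qed.

Lemma rnormC s : rnorm s%:C = `|s|.
Proof.
by apply/eqP; rewrite -(@eqrXn2 _ 2)// ?rnorm_ge0// sqr_rnorm/= expr0n addr0 real_normK// num_real.
Qed.

Lemma rnormX z k : rnorm (z ^+ k) = rnorm z ^+ k.
Proof.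
by apply: complexI; rewrite rmorphXn/= !rnormE normrX.
Qed.

Lemma expiD s t : expi (s + t) = expi s * expi t.
Proof.
rewrite /expi cosD sinD; apply/eqP; rewrite eq_complex/= eqxx/=.
by rewrite addrC.
Qed.

Lemma expi0 : expi 0 = 1 :> R[i].
Proof. by rewrite /expi cos0 sin0. Qed.

Lemma expiJ s : (expi s)^*%R = expi (- s).
Proof. by rewrite conjcE /expi cosN sinN. Qed.

Lemma expiMn s k : expi s ^+ k = expi (k%:R * s).
Proof.
elim: k => [|k IH]; first by rewrite mul0r expi0.
by rewrite exprS IH -expiD mulrSr mulrDl mul1r addrC.
Qed.

Lemma expi_sum I (r : seq I) (Q : pred I) (F : I -> R) :
  expi (\sum_(i <- r | Q i) F i) = \prod_(i <- r | Q i) expi (F i).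
Proof. exact: (big_morph (@expi R) expiD expi0). Qed.

Lemma rnorm_expi s : rnorm (expi s) = 1.
Proof.
apply/eqP; rewrite -(@eqrXn2 _ 2)// ?rnorm_ge0// sqr_rnorm/=.
by rewrite cos2Dsin2 expr1n.
Qed.

End complex_parts.

(** * Trigonometric polynomials and Parseval's identity *)

Section trigonometric_polynomials.
Context {R : realType} (n : nat).
Local Notation T := (measurableTypeR R).

Definition character (k : 'I_n -> nat) (t : n.-tuple T) : R[i] :=
  expi (\sum_(i < n) (k i)%:R * tnth t i).

Lemma characterM k l t :
  character k t * character l t = character (fun i => k i + l i)%N t.
Proof.
rewrite -expiD -big_split/=; congr expi; apply: eq_bigr => i _.
by rewrite natrD mulrDl.
Qed.

Lemma characterMJ k l t : character k t * (character l t)^*%R =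
  expi (\sum_(i < n) ((k i)%:Z - (l i)%:Z)%:~R * tnth t i).
Proof.
rewrite /character expiJ -expiD -sumrN -big_split/=; congr expi; apply: eq_bigr => i _.
by rewrite -mulNr -mulrDl rmorphB.
Qed.

Context {I : finType} (Q : pred I) (k : I -> 'I_n -> nat).
Implicit Types c : I -> R[i].

Definition trigpoly c t : R[i] := \sum_(a | Q a) character (k a) t * c a.

(* With G a b = <x_a, x_b>, this is the squared norm of the trigonometric
   polynomial with coefficients x_a in an inner product space. *)
Definition gram_sum (G : I -> I -> R[i]) (t : n.-tuple T) : R :=
  \sum_(a | Q a) \sum_(b | Q b) complex.Re
    (G a b * (character (k a) t * (character (k b) t)^*%R)).

Lemma gram_sumE G t : gram_sum G t = \sum_(a | Q a) \sum_(b | Q b)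
  complex.Re (G a b * expi (\sum_(i < n) ((k a i)%:Z - (k b i)%:Z)%:~R * tnth t i)).
Proof. by under eq_bigr do under eq_bigr do rewrite -characterMJ. Qed.

(** Orthogonality of characters. Distinct indices may carry the same frequency; the fourth-moment
    bound relies on counting such coincidences. *)
Lemma Rint_gram_sum G : \int[torus_prob n]_t gram_sum G t =
  \sum_(a | Q a) \sum_(b | Q b) [forall i, k a i == k b i]%:R * complex.Re (G a b).
Proof.
under eq_Rintegral do rewrite gram_sumE.
rewrite Rint_sum; last first.
  move=> a; apply: bounded_mfun_sum => b; exact: bounded_mfun_Re_expi.
apply: eq_bigr => a _; rewrite Rint_sum; last first.
  by move=> b; exact: bounded_mfun_Re_expi.
apply: eq_bigr => b _; rewrite Rint_torus_Re_expi; congr (_%:R * _).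
by congr nat_of_bool; apply: eq_forallb => i; rewrite subr_eq0 eqz_nat.
Qed.

Lemma parseval_gram_sum G :
  (forall a b, Q a -> Q b -> (forall i, k a i = k b i) -> a = b) ->
  \int[torus_prob n]_t gram_sum G t = \sum_(a | Q a) complex.Re (G a a).
Proof.
move=> kinj; rewrite Rint_gram_sum; apply: eq_bigr => a Qa.
rewrite (bigD1 a)//= big1 ?addr0 => [|b /andP[Qb ba]].
  by rewrite (_ : [forall i, _]) ?mul1r//; apply/forallP.
case: (boolP [forall i, _]) => [/forallP kab|]; last by rewrite mul0r.
by case/eqP: ba; apply: kinj => // i; apply/esym/eqP.
Qed.

Lemma sqr_rnorm_trigpoly c t :
  rnorm (trigpoly c t) ^+ 2 = gram_sum (fun a b => c a * (c b)^*%R) t.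
Proof.
rewrite sqr_rnormE /trigpoly rmorph_sum/= mulr_suml Re_sum.
apply: eq_bigr => a _; rewrite mulr_sumr Re_sum; apply: eq_bigr => b _.
by congr complex.Re; rewrite rmorphM/=; ring.
Qed.

End trigonometric_polynomials.

Section trigonometric_polynomial_L4.
Context {R : realType} (n : nat) {I : finType} (Q : pred I) (k : I -> 'I_n -> nat).

Let Q2 : pred (I * I) := fun p => Q p.1 && Q p.2.
Let k2 (p : I * I) i := (k p.1 i + k p.2 i)%N.

Lemma sqr_trigpoly (c : I -> R[i]) t :
  trigpoly Q k c t ^+ 2 = trigpoly Q2 k2 (fun p => c p.1 * c p.2) t.
Proof.
rewrite expr2 /trigpoly mulr_suml.
under eq_bigr do rewrite mulr_sumr.
rewrite pair_big/=; apply: eq_bigr => -[a b] _ /=.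
by rewrite -characterM; ring.
Qed.

(** The square of the polynomial is again a trigonometric polynomial, indexed by pairs with added
    frequencies. Its L^2 norm is a sum over pairs of pairs with equal frequency, and [K] bounds the
    number of partners of each pair. *)
Lemma trigpoly_L4 (c : I -> R[i]) (K : R) :

  (forall p, Q2 p -> #|[pred p' | Q2 p' & [forall i, k2 p i == k2 p' i]]|%:R <= K) ->
  \int[torus_prob n]_t (rnorm (trigpoly Q k c t) ^+ 4) <=
  K * (\sum_(a | Q a) rnorm (c a) ^+ 2) ^+ 2.
Proof.
move=> Kle.
rewrite (_ : (fun t => _) = fun t => rnorm (trigpoly Q2 k2 (fun p => c p.1 * c p.2) t) ^+ 2); last first.
  by apply/funext => t; rewrite -sqr_trigpoly rnormX -exprM.
under eq_Rintegral do rewrite sqr_rnorm_trigpoly.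
rewrite Rint_gram_sum; set C := fun p : I * I => c p.1 * c p.2.
pose e p p' := [forall i, k2 p i == k2 p' i].
have eC p p' : e p p' = e p' p by apply: eq_forallb => i; rewrite eq_sym.
(* AM-GM for each coinciding couple; the symmetry [eC] then merges the two halves. *)
apply: (@le_trans _ _ (\sum_(p | Q2 p) \sum_(p' | Q2 p')
   (e p p')%:R * ((rnorm (C p) ^+ 2 + rnorm (C p') ^+ 2) / 2))).
  apply: ler_sum => p _; apply: ler_sum => p' _; apply: ler_wpM2l => //.
  apply: le_trans (Re_le_rnorm _) _; rewrite rnormM rnormJ.
  by have := sqr_ge0 (rnorm (C p) - rnorm (C p')); nra.
pose N p := \sum_(p' | Q2 p') (e p p')%:R : R.
have -> : \sum_(p | Q2 p) \sum_(p' | Q2 p')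
   (e p p')%:R * ((rnorm (C p) ^+ 2 + rnorm (C p') ^+ 2) / 2) =
   \sum_(p | Q2 p) N p * rnorm (C p) ^+ 2.
  under eq_bigr => p _ do under eq_bigr => p' _ do
    rewrite mulrDl mulrDr.
  under eq_bigr => p _ do rewrite big_split/=.
  rewrite big_split/= [X in _ + X]exchange_big/= -big_split/=.
  apply: eq_bigr => p _; rewrite /N mulr_suml -big_split/=.
  by apply: eq_bigr => p' _; rewrite eC; field.
have -> : (\sum_(a | Q a) rnorm (c a) ^+ 2) ^+ 2 = \sum_(p | Q2 p) rnorm (C p) ^+ 2.
  rewrite expr2 mulr_suml; under eq_bigr do rewrite mulr_sumr.
  rewrite pair_big/=; apply: eq_bigr => -[a b] _ /=.
  by rewrite -exprMn -rnormM.
rewrite mulr_sumr; apply: ler_sum => p Qp; apply: ler_wpM2r; first exact: sqr_ge0.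
apply: le_trans (Kle _ Qp); rewrite /N -natr_sum ler_nat -sum1_card.
rewrite big_mkcond [leqRHS]big_mkcond; apply: leq_sum => p' _.
by rewrite inE /=; case: (Q2 p'); rewrite /e; case: [forall i, _].
Qed.

End trigonometric_polynomial_L4.

Section rnorm_normed_module.
Context {R : realType} {V : normedModType R[i]}.
Implicit Types (x y : V) (c : R[i]).

Lemma rnormZ c x : rnorm (c *: x) = rnorm c * rnorm x.
Proof. by apply: complexI; rewrite rmorphM/= !rnormE normrZ. Qed.

Lemma rnormN x : rnorm (- x) = rnorm x.
Proof. by rewrite /rnorm normrN. Qed.

Lemma rnorm_sum I (r : seq I) (Q : pred I) (F : I -> V) :
  rnorm (\sum_(i <- r | Q i) F i) <= \sum_(i <- r | Q i) rnorm (F i).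
Proof.
apply: (big_ind2 (fun x s => rnorm x <= s)) => // [|x1 x2 y1 y2 h1 h2].
  by rewrite rnorm0.
exact: le_trans (ler_rnormD _ _) (lerD h1 h2).
Qed.

Lemma ler_rnormB x y : rnorm x - rnorm y <= rnorm (x - y).
Proof. by rewrite lerBlDr -{1}(subrK y x) ler_rnormD. Qed.

End rnorm_normed_module.

(** * Measurability of the norm of a vector-valued polynomial *)

Section vector_polynomials.
Context {R : realType} (V : normedModType R[i]) {I : finType} (Q : pred I).

Lemma rnorm_le_ReIm (z : R[i]) : rnorm z <= `|complex.Re z| + `|complex.Im z|.
Proof.
rewrite -(@ler_pXn2r _ 2)// ?nnegrE ?rnorm_ge0 ?addr_ge0// sqr_rnorm.
rewrite sqrrD !real_normK ?num_real// -subr_ge0.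
rewrite (_ : _ - _ = `|complex.Re z| * `|complex.Im z| *+ 2); last by ring.
by rewrite mulrn_wge0// mulr_ge0.
Qed.

Lemma rat_dense_approx (x e : R) : 0 < e -> exists r : rat, `|x - ratr r| < e.
Proof.
move=> e0; have /rat_in_itvoo[r] : x - e < x + e.
  by rewrite ltrBlDr -addrA ltrDl addr_gt0.
rewrite in_itv/= => /andP[xr rx]; exists r.
by rewrite ltr_distl; apply/andP; split; lra.
Qed.

(* The norm of a linear combination is 1-Lipschitz in its coefficients, so it
   is the supremum of countably many Lipschitz minorants, one for each choice
   of Gaussian rational coefficients. *)
Lemma measurable_rnorm_comb d (T : measurableType d) (h : I -> T -> R[i]) (x : I -> V) :
  (forall a, measurable_fun setT (fun t => complex.Re (h a t))) ->
  (forall a, measurable_fun setT (fun t => complex.Im (h a t))) ->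
  measurable_fun setT (fun t => rnorm (\sum_(a | Q a) h a t *: x a)).
Proof.
move=> mRe mIm.
pose q (r : rat * rat) : R[i] := (ratr r.1) +i* (ratr r.2).
pose D (r : rat * rat) (z : R[i]) : R :=
  `|complex.Re z - ratr r.1| + `|complex.Im z - ratr r.2|.
pose psi (r : {ffun I -> rat * rat}) t : R :=
  rnorm (\sum_(a | Q a) q (r a) *: x a) - \sum_(a | Q a) D (r a) (h a t) * rnorm (x a).
pose F t := rnorm (\sum_(a | Q a) h a t *: x a).
have dist (r : {ffun I -> rat * rat}) t :
    rnorm (\sum_(a | Q a) q (r a) *: x a - \sum_(a | Q a) h a t *: x a) <=
    \sum_(a | Q a) D (r a) (h a t) * rnorm (x a).
  rewrite -sumrB; apply: le_trans (rnorm_sum _ _ _) _.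
  apply: ler_sum => a _; rewrite -scalerBl rnormZ ler_wpM2r ?rnorm_ge0//.
  apply: le_trans (rnorm_le_ReIm _) _; rewrite /D /q.
  by case: (h a t) => u v /=; rewrite distrC [X in _ + X <= _]distrC.
have psi_le r t : psi r t <= F t.
  by rewrite /psi /F lerBlDr -lerBlDl; apply: le_trans (dist r t); exact: ler_rnormB.
have psi_ge (r : {ffun I -> rat * rat}) t : F t - 2 * \sum_(a | Q a) D (r a) (h a t) * rnorm (x a) <= psi r t.
  have := ler_rnormB (\sum_(a | Q a) h a t *: x a) (\sum_(a | Q a) q (r a) *: x a).
  by rewrite -[X in _ <= X]rnormN opprB => /le_trans/(_ (dist r t)); rewrite /psi /F; lra.
have mpsi (r : {ffun I -> rat * rat}) : measurable_fun setT (psi r).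
  apply: measurable_funB => //.
  under [X in measurable_fun _ X]eq_fun do rewrite big_mkcond/=.
  apply: measurable_sum => a; case: (Q a); last exact: measurable_cst.
  apply: measurable_funM => //; apply: measurable_funD.
    by apply: measurableT_comp => //; exact: measurable_funB.
  by apply: measurableT_comp => //; exact: measurable_funB.
apply: (measurability _ (RGenOInfty.measurableE R)) => //.
move=> /= _ [_ [y ->] <-]; rewrite setTI preimage_itvoy -/F.
rewrite [X in measurable X](_ : _ = \bigcup_r [set t | y < psi r t]).
  apply: countable_bigcupT_measurable => [|r]; first exact: countableP.
  by rewrite -preimage_itvoy -[X in measurable X]setTI; apply: mpsi.
apply/seteqP; split=> [t /= yF|t [r _ /=] /lt_le_trans]; last exact.
pose S := \sum_(a | Q a) rnorm (x a).
have S0 : 0 <= S by apply: sumr_ge0 => a _; exact: rnorm_ge0.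
(* With all real and imaginary parts approximated within [e], the minorant loses at most 4 e S,
   which is less than F t - y. The term S + 1 avoids a zero denominator. *)
pose e := (F t - y) / (8 * (S + 1)).
have e0 : 0 < e by rewrite divr_gt0 ?subr_gt0// mulr_gt0// ltr_pwDr.
have /choice[r1 r1P] a := rat_dense_approx (complex.Re (h a t)) e0.
have /choice[r2 r2P] a := rat_dense_approx (complex.Im (h a t)) e0.
exists [ffun a => (r1 a, r2 a)] => //=; apply: lt_le_trans (psi_ge _ _).
apply: (@lt_le_trans _ _ (F t - 2 * (2 * e * S))); last first.
  rewrite lerD2l lerN2 ler_wpM2l// mulr_sumr; apply: ler_sum => a _.
  rewrite ler_wpM2r ?rnorm_ge0// /D ffunE/=.
  by have := r1P a; have := r2P a; lra.
rewrite ltrBrDl -ltrBrDr -ltr_pdivlMl// /e.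
rewrite (_ : 2 * (_ / _) * S = (F t - y) / 4 * (S / (S + 1))); last first.
  by field; rewrite gt_eqF// ltr_pwDr.
have FSy : 0 < F t - y by rewrite subr_gt0.
have : S / (S + 1) <= 1 by rewrite ler_pdivrMr ?mul1r ?lerDl// ltr_pwDr.
by nra.
Qed.

End vector_polynomials.

Section vector_integrals.
Context {R : realType} (n : nat).
Local Notation T := (measurableTypeR R).

Lemma bounded_mfun_rnorm_comb (V : normedModType R[i]) (I : finType) (Q : pred I)
    (phi : I -> n.-tuple T -> R) (x : I -> V) :
  (forall a, measurable_fun setT (phi a)) ->
  bounded_mfun (fun t => rnorm (\sum_(a | Q a) expi (phi a t) *: x a)).
Proof.
move=> mphi; split.
  apply: (measurable_rnorm_comb Q (h := fun a t => expi (phi a t))) => a /=.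
    apply: (measurableT_comp (f := cos)) => //.
    by apply: continuous_measurable_fun; exact: continuous_cos.
  apply: (measurableT_comp (f := sin)) => //.
  by apply: continuous_measurable_fun; exact: continuous_sin.
exists (\sum_(a | Q a) rnorm (x a)) => t.
rewrite ger0_norm ?rnorm_ge0//; apply: le_trans (rnorm_sum _ _ _) _.
by apply: ler_sum => a _; rewrite rnormZ rnorm_expi mul1r.
Qed.

Lemma measurable_phase (k : 'I_n -> nat) :
  measurable_fun setT (fun t : n.-tuple T => \sum_(i < n) (k i)%:R * tnth t i : R).
Proof.
apply: measurable_sum => i; apply: measurable_funM => //; exact: measurable_tnth.
Qed.

End vector_integrals.

(** * Homogeneous polynomials on the torus *)

Section multi_indices.
Context {R : realType} (N m : nat).
Local Notation T := (measurableTypeR R).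
Implicit Types a b : multi_index N m.

Definition multi_exp a (i : 'I_N) : nat := a i.

Lemma monomial_expi (t : N.-tuple T) a :
  monomial (map_tuple (@expi R) t) a = character (multi_exp a) t.
Proof.
rewrite /monomial /character expi_sum; apply: eq_bigr => i _.
by rewrite tnth_map expiMn.
Qed.

Lemma multi_exp_inj a b : (forall i, multi_exp a i = multi_exp b i) -> a = b.
Proof. by move=> ab; apply/ffunP => i; apply/val_inj/ab. Qed.

Lemma bounded_mfun_rnorm_monomials (V : normedModType R[i]) (Q : pred (multi_index N m))
   (x : multi_index N m -> V) :
  bounded_mfun (fun t : N.-tuple T =>
    rnorm (\sum_(a | Q a) monomial (map_tuple (@expi R) t) a *: x a)).
Proof.
under [X in bounded_mfun X]eq_fun do under eq_bigr do rewrite monomial_expi.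
exact: (@bounded_mfun_rnorm_comb R N V _ Q _ x (fun a => measurable_phase (multi_exp a))).
Qed.

Lemma card_ord_le g : (#|[pred j : 'I_m.+1 | j <= g]| <= g.+1)%N.
Proof.
rewrite -[g.+1]card_ord; apply: (leq_card_in (fun j : 'I_m.+1 => inord j : 'I_g.+1)).
move=> i j; rewrite !inE => ig jg /(congr1 val); rewrite /= !inordK// => ij.
exact: val_inj.
Qed.

(* A summand of a decomposition of a degree 2m multi-index g is bounded
   coordinatewise by g, which leaves at most
   prod (g_i + 1) <= 2 ^ (2m) choices. *)
Lemma card_decompositions (p : multi_index N m * multi_index N m) :
  degree p.1 = m -> degree p.2 = m ->
  (#|[pred p' : multi_index N m * multi_index N m |
     [forall i, multi_exp p.1 i + multi_exp p.2 i ==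
                multi_exp p'.1 i + multi_exp p'.2 i]]| <= 4 ^ m)%N.
Proof.
move=> d1 d2; pose g i := (multi_exp p.1 i + multi_exp p.2 i)%N.
set S := [pred p' | _].
have inj1 : {in S &, injective (@fst (multi_index N m) (multi_index N m))}.
  move=> [a b] [a' b'] /forallP/= h /forallP/= h' /= aa'; rewrite aa' in h *.
  congr (_, _); apply: multi_exp_inj => i; apply/eqP.
  by rewrite -(eqn_add2l (multi_exp a' i)) -(eqP (h i)) (h' i).
rewrite -(card_in_image inj1).
pose F (i : 'I_N) := [pred j : 'I_m.+1 | (j <= g i)%N].
apply: (@leq_trans #|(family F : simpl_pred {ffun 'I_N -> 'I_m.+1})|).
  apply: subset_leq_card; apply/fintype.subsetP => a /mapP[w]; rewrite mem_enum => /forallP h ->.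
  by apply/familyP => i; rewrite inE /g (eqP (h i)); exact: leq_addr.
rewrite card_family foldrE big_map big_enum/=.
apply: (@leq_trans (\prod_(i < N) 2 ^ g i)).
  by apply: leq_prod => i _; apply: leq_trans (card_ord_le _) (ltn_expl _ _).
by rewrite -expn_sum big_split/= [X in (X + _)%N]d1 [X in (_ + X)%N]d2 addnn -muln2 mulnC expnM.
Qed.

Let Q : pred (multi_index N m) := fun a => degree a == m.

Lemma parseval_monomials (c : multi_index N m -> R[i]) :
  \int[torus_prob N]_t (rnorm (\sum_(a | degree a == m)
     monomial (map_tuple (@expi R) t) a *: (c a : R[i]^o)) ^+ 2)
  = \sum_(a | degree a == m) rnorm (c a) ^+ 2.
Proof.
under eq_Rintegral do under eq_bigr do rewrite monomial_expi.
under eq_Rintegral do rewrite (sqr_rnorm_trigpoly Q (fun a => multi_exp a)).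
rewrite parseval_gram_sum => [|a b _ _]; last exact: multi_exp_inj.
by under eq_bigr do rewrite -sqr_rnormE.
Qed.

(** The fourth-moment bound holds with 4 ^ m by [card_decompositions]. This is the square of 2 ^ m,
    so [Rint_L2_le_L1] applies with k = 2 ^ m. *)
Lemma hypercontractive_monomials (c : multi_index N m -> R[i]) :
  Num.sqrt (\sum_(a | degree a == m) rnorm (c a) ^+ 2) <=
  2 ^+ m * \int[torus_prob N]_t rnorm (\sum_(a | degree a == m)
     monomial (map_tuple (@expi R) t) a *: (c a : R[i]^o)).
Proof.
rewrite -parseval_monomials; apply: Rint_L2_le_L1.
- exact: bounded_mfun_rnorm_monomials.
- by move=> t; exact: rnorm_ge0.
- by rewrite exprn_gt0.
rewrite parseval_monomials.
under eq_Rintegral do under eq_bigr do rewrite monomial_expi.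
apply: (@trigpoly_L4 R N _ Q (fun a => multi_exp a)) => p /andP[/eqP d1 /eqP d2].
rewrite -exprM mulnC exprM -natrX -natrX ler_nat.
apply: leq_trans (card_decompositions d1 d2); apply: subset_leq_card; apply/fintype.subsetP => p'.
by rewrite !inE => /andP[].
Qed.

End multi_indices.

(** * Spaces with l_r structure *)

Section extend_linear.
Context {K : fieldType} {V : lmodType K} (n : nat) (u : {linear 'rV[K]_n -> V}) (v : V).

Definition extend_linear (a : 'rV[K]_(n + 1)) : V :=
  u (lsubmx a) + (rsubmx a) 0 0 *: v.

Lemma extend_linear_is_linear : linear extend_linear.
Proof.
move=> c a b; rewrite /extend_linear !linearP/= !mxE scalerDl scalerDr !scalerA.
by rewrite addrACA.
Qed.

HB.instance Definition _ :=
  GRing.isLinear.Build K 'rV[K]_(n + 1) V _ extend_linear extend_linear_is_linear.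

Lemma extend_linear_inj : injective u -> ~ range u v -> injective extend_linear.
Proof.
move=> uinj vu; apply: raddf_inj => a; rewrite /extend_linear/= => a0.
have r0 : (rsubmx a) 0 0 = 0.
  apply: contrapT => /eqP r0; apply: vu.
  exists (- ((rsubmx a 0 0)^-1 *: lsubmx a)) => //.
  rewrite raddfN/= linearZZ -scalerN.
  move: a0 => /eqP; rewrite addr_eq0 => /eqP ->.
  by rewrite opprK scalerA mulVf// scale1r.
move: a0; rewrite /extend_linear r0 scale0r addr0 => /eqP; rewrite raddf_eq0// => /eqP l0.
rewrite -(hsubmxK a) l0 (_ : rsubmx a = 0) ?row_mx0//.
by apply/rowP => i; rewrite ord1 r0 mxE.
Qed.

End extend_linear.

(** A coordinate is added only for a vector outside the current range, which keeps the map
    injective. The range is the finite-dimensional subspace to which [Lr_space] is applied. *)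
Lemma span_coordinates (K : fieldType) (V : lmodType K) (s : seq V) :
  exists n (u : {linear 'rV[K]_n -> V}), injective u /\ {in s, forall v, range u v}.
Proof.
elim: s => [|v s [n [u [uinj us]]]].
  exists 0%N, (\0 : {linear 'rV[K]_0 -> V}); split=> //.
  by move=> a b _; apply/rowP => -[].
have [vu|vu] := pselect (range u v).
  exists n, u; split=> // w; rewrite inE => /predU1P[->//|]; exact: us.
exists (n + 1)%N, (extend_linear u v : {linear _ -> _}); split.
  exact: extend_linear_inj.
move=> w; rewrite inE => /predU1P[->|/us[a _ <-]].
  exists (row_mx 0 1) => //=.
  by rewrite /extend_linear row_mxKl row_mxKr linear0 add0r mxE eqxx scale1r.
by exists (row_mx a 0) => //=; rewrite /extend_linear row_mxKl row_mxKr mxE scale0r addr0.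
Qed.

Section lr_norm_theory.
Context {R : realType}.
Implicit Types (r : \bar R).

Lemma bigmax_rnorm_ge0 n (y : 'I_n -> R) : 0 <= \big[Num.max/0]_(i < n) y i.
Proof. by elim/big_rec: _ => // i x _ x0; rewrite le_max x0 orbT. Qed.

Lemma lr_norm_ge0 r n (a : 'rV[R[i]]_n) : 0 <= lr_norm r a.
Proof. by case: r => [r||] /=; [exact: powR_ge0|exact: bigmax_rnorm_ge0|exact: bigmax_rnorm_ge0]. Qed.

Lemma le_coord_lr_norm r n (a : 'rV[R[i]]_n) i : (1 <= r)%E ->
  rnorm (a 0 i) <= lr_norm r a.
Proof.
case: r => [r||]//=; last by move=> _; exact: le_bigmax.
rewrite lee_fin => r1.
apply: (@le_lp_coord _ _ xpredT r (fun i => rnorm (a 0 i))) => //.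
  exact: lt_le_trans r1.
exact: rnorm_ge0.
Qed.

Lemma lp1 (I : finType) (y : I -> R) : (forall i, 0 <= y i) ->
  lp xpredT 1 y = \sum_i y i.
Proof.
move=> y0; rewrite /lp invr1 powRr1 ?sum_powR_ge0//.
by apply: eq_bigr => i _; rewrite powRr1.
Qed.

Lemma lr_norm_le_sum r n (a : 'rV[R[i]]_n) : (1 <= r)%E ->
  lr_norm r a <= \sum_i rnorm (a 0 i).
Proof.
case: r => [r||]//=.
  rewrite lee_fin => r1; rewrite -[leRHS]lp1; last by move=> i; exact: rnorm_ge0.
  apply: (@lp_le_lp _ _ xpredT 1 r) => // i _; exact: rnorm_ge0.
move=> _; apply/bigmax_leP; split=> [|i _].
  by apply: sumr_ge0 => i _; exact: rnorm_ge0.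
by rewrite (bigD1 i)//= lerDl; apply: sumr_ge0 => j _; exact: rnorm_ge0.
Qed.

Lemma lr_norm0_eq0 r n (a : 'rV[R[i]]_n) : (1 <= r)%E -> lr_norm r a = 0 -> a = 0.
Proof.
move=> r1 a0; apply/rowP => i; rewrite mxE; apply: rnorm0_eq0; apply/eqP.
by rewrite eq_le rnorm_ge0 andbT -a0 le_coord_lr_norm.
Qed.

Lemma lr_normZ r n (c : R[i]) (a : 'rV[R[i]]_n) : (1 <= r)%E ->
  lr_norm r (c *: a) = rnorm c * lr_norm r a.
Proof.
case: r => [r||]//=.
  rewrite lee_fin => r1; have r0 : 0 < r by apply: lt_le_trans r1.
  transitivity (lp xpredT r (fun i => rnorm c * rnorm (a 0 i))); last first.
    by apply: lpZ => [||i _] //; exact: rnorm_ge0.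
  by rewrite /lp; congr (_ `^ _); apply: eq_bigr => i _; rewrite mxE rnormM.
move=> _; rewrite (eq_bigr (fun i => rnorm c * rnorm (a 0 i))); last first.
  by move=> i _; rewrite mxE rnormM.
elim: n a => [a|n IH a]; first by rewrite !big_ord0 mulr0.
rewrite !big_ord_recl maxr_pMr ?rnorm_ge0//; congr (Num.max _ _).
have := IH (\row_j a 0 (lift ord0 j)).
by under eq_bigr do rewrite mxE; under [in RHS]eq_bigr do rewrite mxE.
Qed.

(** With 1 / oo = 0, the comparison of [r] with the cotype exponent reads the same for finite and
    infinite [r]. *)
Definition inv_exponent r : R := if r is r'%:E then r'^-1 else 0.

Lemma lr_norm_unimodular r n (a : 'rV[R[i]]_n) : (1 <= r)%E ->
  (forall i, rnorm (a 0 i) = 1) -> lr_norm r a <= n%:R `^ inv_exponent r.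
Proof.
case: r => [r||]//= r1 a1.
  apply: ler_powR2; first by rewrite invr_ge0 (le_trans _ (r1 : 1 <= r)).
    by apply: sumr_ge0 => i _; exact: powR_ge0.
  rewrite (eq_bigr (fun=> 1)) ?sumr_const ?card_ord// => i _.
  by rewrite a1 powR1.
by rewrite powRr0; apply/bigmax_leP; split=> // i _; rewrite a1.
Qed.

End lr_norm_theory.

Section Lr_space_coordinates.
Context {R : realType} (X : completeNormedModType R[i]) (r : \bar R).
Hypothesis r1 : (1 <= r)%E.

(** Normalize [v] by homogeneity. The lemma serves for the coordinate map and for its inverse, by
    exchanging the two norms. *)
Lemma ereal_sup_ball_le (V : lmodType R[i]) (N1 N2 : V -> R) (A : R) :
  (forall (c : R[i]) v, N1 (c *: v) = rnorm c * N1 v) ->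
  (forall (c : R[i]) v, N2 (c *: v) = rnorm c * N2 v) ->
  (forall v, 0 <= N1 v) -> (forall v, N1 v = 0 -> v = 0) ->
  (ereal_sup [set (N2 v)%:E | v in [set v | (N1 v <= 1)%R]] <= A%:E)%E ->
  forall v, N2 v <= A * N1 v.
Proof.
move=> N1Z N2Z N10 N1eq0 supA v; have [/N1eq0 ->|v0] := eqVneq (N1 v) 0.
  by rewrite -(scale0r 0) N1Z N2Z rnorm0 !mul0r mulr0.
have {}v0 : 0 < N1 v by rewrite lt_def v0 N10.
have rv : rnorm ((N1 v)^-1%:C : R[i]) = (N1 v)^-1.
  by rewrite rnormC ger0_norm// invr_ge0.
rewrite mulrC -ler_pdivrMl// -rv -N2Z -lee_fin; apply: le_trans supA.
apply: ereal_sup_ubound => /=; exists ((N1 v)^-1%:C *: v) => //.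
by rewrite N1Z rv mulVf// gt_eqF.
Qed.

(** The infimum defining the Banach-Mazur distance need not be attained; the bound [lambda + 1]
    leaves room for an actual isomorphism, whose two operator norms serve as [A] and [B]. *)
Lemma Lr_space_coordinates : Lr_space X r ->
  exists2 L : R, 1 <= L & forall s : seq X,
  exists n (u : {linear 'rV[R[i]]_n -> X}) (A B : R),
  [/\ 0 < A, 0 < B, A * B <= L, {in s, forall v, range u v} &
      forall a, rnorm (u a) <= A * lr_norm r a /\ lr_norm r a <= B * rnorm (u a)].
Proof.
move=> [lambda l1 HX]; exists (lambda + 1); first by rewrite lerDr ltW// (lt_trans _ l1).
move=> s; have [n0 [u0 [u0inj u0s]]] := span_coordinates s.
have [|n [F [_ u0F]]] := HX (range u0); first by exists n0, u0.
move=> bm; have /ereal_inf_lt[_ [u [uinj uF] <-]] :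
    (banach_mazur_lr r n F < (lambda + 1)%:E)%E.
  by apply: le_lt_trans bm _; rewrite lte_fin ltrDl.
set SA := ereal_sup _; set SB := ereal_sup _ => AB.
have su : {in s, forall v, range u v} by move=> v /u0s ?; rewrite uF; exact: u0F.
(* In dimension 0 both suprema vanish, so the positive constants are taken to be 1. *)
case: n => [|n] in u uinj uF SA SB AB su bm *.
  exists 0%N, u, 1, 1; split=> //; first by rewrite mul1r lerDr ltW// (lt_trans _ l1).
  move=> a; have -> : a = 0 by apply/rowP => -[].
  have l0 : lr_norm r (0 : 'rV[R[i]]_0) = 0.
    by rewrite -(scale0r 0) lr_normZ// rnorm0 mul0r.
  by rewrite linear0 rnorm0 l0 mulr0.
pose e : 'rV[R[i]]_n.+1 := delta_mx 0 0.
have e0 : e != 0.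
  by apply/eqP => /rowP/(_ 0); rewrite !mxE !eqxx => /eqP; rewrite oner_eq0.
have uZ (c : R[i]) v : rnorm (u (c *: v)) = rnorm c * rnorm (u v).
  by rewrite linearZ/= rnormZ.
have u_eq0 v : rnorm (u v) = 0 -> v = 0.
  by move=> /rnorm0_eq0/eqP; rewrite raddf_eq0// => /eqP.
(* Both suprema are positive, as the basis vector [e] shows; hence the finite bound on their product
   makes each of them finite. *)
have nrm_gt0 (N1 N2 : 'rV[R[i]]_n.+1 -> R) :
    (forall (c : R[i]) v, N1 (c *: v) = rnorm c * N1 v) ->
    (forall (c : R[i]) v, N2 (c *: v) = rnorm c * N2 v) ->
    (forall v, 0 <= N1 v) -> (forall v, N1 v = 0 -> v = 0) ->
    (forall v, 0 <= N2 v) -> (forall v, N2 v = 0 -> v = 0) ->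
    (0 < ereal_sup [set (N2 v)%:E | v in [set v | (N1 v <= 1)%R]])%E.
  move=> N1Z N2Z N10 N1eq0 N20 N2eq0.
  have N1e : 0 < N1 e.
    by rewrite lt_def N10 andbT; apply/eqP => /N1eq0 /eqP; rewrite (negbTE e0).
  have N2e : 0 < N2 e.
    by rewrite lt_def N20 andbT; apply/eqP => /N2eq0 /eqP; rewrite (negbTE e0).
  have rv : rnorm ((N1 e)^-1%:C : R[i]) = (N1 e)^-1.
    by rewrite rnormC ger0_norm// invr_ge0.
  apply: (@lt_le_trans _ _ (N2 ((N1 e)^-1%:C *: e))%:E).
    by rewrite lte_fin N2Z rv mulr_gt0// invr_gt0.
  apply: ereal_sup_ubound => /=; exists ((N1 e)^-1%:C *: e) => //.
  by rewrite N1Z rv mulVf// gt_eqF.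
have SA0 : (0 < SA)%E.
  apply: nrm_gt0 => //.
  - by move=> c v; rewrite lr_normZ.
  - by move=> v; exact: lr_norm_ge0.
  - by move=> v; exact: lr_norm0_eq0.
  - by move=> v; exact: rnorm_ge0.
have SB0 : (0 < SB)%E.
  apply: nrm_gt0 => //.
  - by move=> c v; rewrite lr_normZ.
  - by move=> v; exact: rnorm_ge0.
  - by move=> v; exact: lr_norm_ge0.
  - by move=> v; exact: lr_norm0_eq0.
have SAfin : SA \is a fin_num.
  rewrite ge0_fin_numE ?ltW// ltNge leye_eq; apply/eqP => SAy.
  by move: AB; rewrite SAy gt0_mulye.
have SBfin : SB \is a fin_num.
  rewrite ge0_fin_numE ?ltW// ltNge leye_eq; apply/eqP => SBy.
  by move: AB; rewrite SBy gt0_muley.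
exists n.+1, u, (fine SA), (fine SB); split=> //.
- by rewrite -lte_fin fineK.
- by rewrite -lte_fin fineK.
- by rewrite -lee_fin EFinM !fineK// ltW.
move=> a; split.
  apply: (@ereal_sup_ball_le _ (fun a => lr_norm r a) (fun a => rnorm (u a))) => //.
  - by move=> c v; rewrite lr_normZ.
  - by move=> v; exact: lr_norm_ge0.
  - by move=> v; exact: lr_norm0_eq0.
  - by rewrite fineK.
apply: (@ereal_sup_ball_le _ (fun a => rnorm (u a)) (fun a => lr_norm r a)) => //.
- by move=> c v; rewrite lr_normZ.
- by move=> v; exact: rnorm_ge0.
- by rewrite fineK.
Qed.

End Lr_space_coordinates.

(** * Coefficient estimates in l_r coordinates *)

Section Lr_hypercontractive.
Context {R : realType}.
Local Notation T := (measurableTypeR R).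

Lemma lp2_sqrt (I : finType) (Q : pred I) (y : I -> R) : (forall i, 0 <= y i) ->
  lp Q 2 y = Num.sqrt (\sum_(i | Q i) y i ^+ 2).
Proof.
move=> y0; rewrite /lp powR12_sqrt ?sum_powR_ge0//.
by congr Num.sqrt; apply: eq_bigr => i _; rewrite powR_mulrn.
Qed.

Lemma Rint_le_sqrt d (S : measurableType d) (P : probability S R) (f : S -> R) :
  bounded_mfun f -> \int[P]_t f t <= Num.sqrt (\int[P]_t (f t ^+ 2)).
Proof.
move=> bf; apply: le_trans (ler_norm _) _; rewrite -sqrtr_sqr.
by apply: ler_wsqrtr; exact: Rint_sqr_le.
Qed.

(* Minkowski's inequality in l_{q/r} *)
Lemma lp_mixed_le (I J : finType) (Q : pred I) (r q : R) (y : I -> J -> R) :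
  0 < r -> r <= q -> (forall i j, 0 <= y i j) ->
  lp Q q (fun i => lp xpredT r (y i)) <= lp xpredT r (fun j => lp Q q (y^~ j)).
Proof.
move=> r0 rq y0; have q0 : 0 < q by apply: lt_le_trans rq.
apply: ler_powR_inv => //; [exact: lp_ge0|exact: sum_powR_ge0|].
have lpr (z : I -> R) : (forall i, 0 <= z i) ->
    lp Q q z `^ r = lp Q (q / r) (fun i => z i `^ r).
  move=> z0; rewrite /lp -powRrM invf_div mulrC; congr (_ `^ _).
  apply: eq_bigr => i _; rewrite -powRrM; congr (_ `^ _); field.
  by rewrite gt_eqF.
rewrite (lpr (fun i => lp xpredT r (y i))); last by move=> i; exact: lp_ge0.
under [leRHS]eq_bigr do rewrite lpr//.
rewrite (_ : (fun i => _) = fun i => \sum_j y i j `^ r); last first.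
  by apply/funext => i; rewrite lp_powR.
apply: (@lp_sum_le _ _ _ Q (q / r) (fun i j => y i j `^ r)).
  by rewrite ler_pdivlMr ?mul1r.
by move=> i j; exact: powR_ge0.
Qed.

Context {N m : nat}.
Local Notation P := (torus_prob N).
Local Notation mono t a := (monomial (map_tuple (@expi R) t) a).

(** The l_q norm is at most the l_2 norm, which scalar hypercontractivity controls by the L^1
    norm. *)
Lemma lp_coef_le (q : R) (c : multi_index N m -> R[i]) : 2 <= q ->
  lp (fun a => degree a == m) q (fun a => rnorm (c a)) <=
  2 ^+ m * \int[P]_t rnorm (\sum_(a | degree a == m) mono t a *: (c a : R[i]^o)).
Proof.
move=> q2; apply: le_trans (hypercontractive_monomials _).
rewrite -(lp2_sqrt (fun a => degree a == m) (y := fun a => rnorm (c a))); last first.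
  by move=> a; exact: rnorm_ge0.
by apply: lp_le_lp => // a _; exact: rnorm_ge0.
Qed.

Context (X : completeNormedModType R[i]) (r : \bar R).
Hypothesis r1 : (1 <= r)%E.
Context (n : nat) (u : {linear 'rV[R[i]]_n -> X}) (A B : R).
Hypotheses (A0 : 0 < A) (B0 : 0 < B).
Hypothesis uA : forall a, rnorm (u a) <= A * lr_norm r a.
Hypothesis uB : forall a, lr_norm r a <= B * rnorm (u a).
Context (x : multi_index N m -> X) (v : multi_index N m -> 'rV[R[i]]_n).
Hypothesis uv : forall a, u (v a) = x a.

Let f t := \sum_(a | degree a == m) mono t a *: x a.
Let g t := \sum_(a | degree a == m) mono t a *: v a.
Let gi i t : R[i]^o := \sum_(a | degree a == m) mono t a *: (v a 0 i : R[i]^o).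

Let ug t : u (g t) = f t.
Proof.
rewrite /g linear_sum; apply: eq_bigr => a _.
by rewrite linearZ/= uv.
Qed.

Let giE i t : gi i t = g t 0 i.
Proof. by rewrite /g summxE; apply: eq_bigr => a _; rewrite mxE. Qed.

Let bf : bounded_mfun (fun t => rnorm (f t)).
Proof. exact: bounded_mfun_rnorm_monomials. Qed.

Let bgi i : bounded_mfun (fun t => rnorm (gi i t)).
Proof. exact: bounded_mfun_rnorm_monomials. Qed.

Let normL2 := Num.sqrt (torus_int (fun z : N.-tuple R[i] =>
  rnorm (\sum_(a | degree a == m) monomial z a *: x a) ^+ 2)).

Let EB : \int[P]_t (B * rnorm (f t)) <= B * normL2.
Proof.
rewrite RintZ// ler_wpM2l ?(ltW B0)//; exact: Rint_le_sqrt.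
Qed.

Let bBf : bounded_mfun (fun t => B * rnorm (f t)).
Proof. apply: bounded_mfunM; [exact: bounded_mfun_cst|exact: bf]. Qed.

(** [lp_mixed_le] moves the l_q norm over multi-indices inside the l_r norm over coordinates,
    [lp_coef_le] treats each coordinate, and [lp_Rint_le] takes the l_r norm under the integral. *)
Lemma Lr_coef_le (q : R) (r' : R) : r = r'%:E -> 2 <= q -> r' <= q ->
  lp (fun a => degree a == m) q (fun a => rnorm (x a)) <= A * B * 2 ^+ m * normL2.
Proof.
move=> rE q2 rq; have r'1 : 1 <= r' by rewrite -lee_fin -rE.
have r'0 : 0 < r' by apply: lt_le_trans r'1.
have q0 : 0 < q by apply: lt_le_trans q2.
have lrE (a : 'rV[R[i]]_n) : lr_norm r a = lp xpredT r' (fun i => rnorm (a 0 i)).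
  by rewrite rE.
apply: (@le_trans _ _ (A * lp (fun a => degree a == m) q
    (fun a => lp xpredT r' (fun i => rnorm (v a 0 i))))).
  rewrite -(lpZ q0 (ltW A0)); last by move=> a _; exact: lp_ge0.
  apply: ler_lp => // a _; rewrite rnorm_ge0/= -uv -lrE; exact: uA.
rewrite -!mulrA; apply: ler_wpM2l; first exact: ltW.
apply: le_trans (lp_mixed_le _ r'0 rq _) _; first by move=> a i; exact: rnorm_ge0.
apply: (@le_trans _ _ (lp xpredT r' (fun i => 2 ^+ m * \int[P]_t rnorm (gi i t)))).
  apply: ler_lp => // i _; rewrite lp_ge0/=; exact: lp_coef_le.
rewrite lpZ ?exprn_ge0//; last by move=> i _; apply: Rint_ge0 => t; exact: rnorm_ge0.
rewrite mulrCA; apply: ler_wpM2l; first exact: exprn_ge0.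
apply: le_trans EB.
apply: (@lp_Rint_le _ _ _ P _ r' (fun i t => rnorm (gi i t))) => //.
  by move=> i t; exact: rnorm_ge0.
move=> t; rewrite -ug; apply: le_trans (uB _); rewrite lrE.
by apply: ler_lp => // i _; rewrite rnorm_ge0/= giE.
Qed.

(** The l_r norm lies between each coordinate and the sum of the coordinates. The lost factor [n] is
    harmless once the dimension is bounded. *)
Lemma Lr_coef_le_dim (q : R) : 2 <= q ->
  lp (fun a => degree a == m) q (fun a => rnorm (x a)) <=
  n%:R * (A * B * 2 ^+ m * normL2).
Proof.
move=> q2; have q0 : 0 < q by apply: lt_le_trans q2.
apply: (@le_trans _ _ (A * lp (fun a => degree a == m) q
    (fun a => \sum_i rnorm (v a 0 i)))).
  rewrite -(lpZ q0 (ltW A0)); last first.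
    by move=> a _; apply: sumr_ge0 => i _; exact: rnorm_ge0.
  apply: ler_lp => // a _; rewrite rnorm_ge0/= -uv; apply: le_trans (uA _) _.
  by rewrite ler_wpM2l ?(ltW A0)// lr_norm_le_sum.
rewrite -!mulrA mulrCA; apply: ler_wpM2l; first exact: ltW.
have q1 : 1 <= q by apply: le_trans q2; rewrite ler1n.
apply: le_trans (lp_sum_le _ q1 _) _; first by move=> a i; exact: rnorm_ge0.
rewrite -[X in X%:R]card_ord -sumr_const mulr_suml; apply: ler_sum => i _.
rewrite mul1r; apply: le_trans (lp_coef_le _ q2) _.
rewrite mulrCA; apply: ler_wpM2l; first exact: exprn_ge0.
apply: le_trans EB.
apply: le_Rint; [exact: bgi|exact: bBf|move=> t]; rewrite -/(gi i t) giE -ug; apply: le_trans (uB _).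
exact: le_coord_lr_norm.
Qed.

End Lr_hypercontractive.

(** * Cotype and the dimension of copies of l_r^n *)

Section Lr_cotype.
Context {R : realType} (X : completeNormedModType R[i]).

(** On the torus all coefficients are unimodular, so the integrand is at most D ^ 2. This test of
    cotype serves both l_r^n and the Schatten classes. *)
Lemma cotype_const_le (q C b D : R) (N : nat) (x : 'I_N -> X) : 0 < q -> 0 <= b -> 0 <= D ->
  0 < C ->
  (\sum_(k < N) rnorm (x k) `^ q) `^ q^-1 <=
    C * Num.sqrt (torus_int (fun z : N.-tuple R[i] =>
                    rnorm (\sum_(k < N) tnth z k *: x k) ^+ 2)) ->
  (forall k, b <= rnorm (x k)) ->
  (forall z : N.-tuple R[i], (forall k, rnorm (tnth z k) = 1) ->
     rnorm (\sum_(k < N) tnth z k *: x k) <= D) ->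
  N%:R `^ q^-1 * b <= C * D.
Proof.
move=> q0 b0 D0 C0 cot bx xD.
apply: (@le_trans _ _ ((\sum_(k < N) rnorm (x k) `^ q) `^ q^-1)).
  apply: ler_powR_inv => //; first by rewrite mulr_ge0 ?powR_ge0.
    exact: sum_powR_ge0.
  rewrite powRM ?powR_ge0// powRVK// -{1}[N]card_ord -sumr_const mulr_suml.
  by apply: ler_sum => k _; rewrite mul1r; apply: ler_powR2; rewrite ?(ltW q0).
apply: le_trans cot _; rewrite ler_wpM2l ?(ltW C0)//.
rewrite -[leRHS]ger0_norm// -sqrtr_sqr; apply: ler_wsqrtr; rewrite /torus_int.
rewrite -[leRHS](Rint_cst (torus_prob N)); apply: le_Rint.
- apply: bounded_mfunX.
  under [X in bounded_mfun X]eq_fun do under eq_bigr do rewrite tnth_map.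
  by apply: bounded_mfun_rnorm_comb => k; exact: measurable_tnth.
- exact: bounded_mfun_cst.
move=> t; rewrite lerXn2r ?nnegrE ?rnorm_ge0//; apply: xD => k.
by rewrite tnth_map rnorm_expi.
Qed.

(** For positive n the inequality says n ^ (q - e) <= K. In its uses [q] and [e] are the reciprocals
    of the cotype exponent and of [r]. *)
Lemma nat_powR_bound (q e K : R) : e < q -> exists n0 : nat, forall n : nat,
  n%:R `^ q <= K * n%:R `^ e -> (n <= n0)%N.
Proof.
move=> eq; pose K' := Num.max K 0; exists (Num.truncn (K' `^ (q - e)^-1)) => -[//|n] nK.
have n0 : 0 < n.+1%:R :> R by [].
have qe : 0 < q - e by rewrite subr_gt0.
rewrite truncn_ge_nat ?powR_ge0//; apply: ler_powR_inv => //.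
  by rewrite le_max lexx orbT.
rewrite powRB ?gt_eqF ?implybT// ler_pdivrMr ?powR_gt0//.
by apply: le_trans nK _; rewrite ler_wpM2r ?powR_ge0// le_max lexx.
Qed.

Lemma Lr_cotype_hypercontractive (r : \bar R) (q : R) : (1 <= r)%E -> 2 <= q ->
  Lr_space X r -> cotype X q -> hypercontractive_homogeneous_cotype X q.
Proof.
move=> r1 q2 /(Lr_space_coordinates r1)[L L1 HX] [C C0 cot].
have q0 : 0 < q by apply: lt_le_trans q2.
have L0 : 0 < L by apply: lt_le_trans L1.
suff [K K1 HK] : exists2 K : R, 1 <= K & forall (m N : nat) (x : multi_index N m -> X),
    lp (fun a => degree a == m) q (fun a => rnorm (x a)) <= K * (2 ^+ m *
       Num.sqrt (torus_int (fun z : N.-tuple R[i] =>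
               rnorm (\sum_(a | degree a == m) monomial z a *: x a) ^+ 2))).
  (* As 0 < m and 1 <= K, the single factor [K] is at most K ^ m. *)
  exists (K * 2) => [|m N x m0]; first by rewrite mulr_gt0// (lt_le_trans _ K1).
  apply: le_trans (HK m N x) _; rewrite exprMn -mulrA ler_wpM2r//.
  by rewrite -[leLHS]expr1 ler_weXn2l.
have coords (m N : nat) (x : multi_index N m -> X) :
  exists n (u : {linear 'rV[R[i]]_n -> X}) (A B : R) (v : multi_index N m -> 'rV_n),
    [/\ 0 < A, 0 < B, A * B <= L, forall a, u (v a) = x a &
      forall a, rnorm (u a) <= A * lr_norm r a /\ lr_norm r a <= B * rnorm (u a)].
  have [n [u [A [B [A0 B0 AB us uAB]]]]] := HX [seq x a | a : multi_index N m].
  have /choice[v uv] (a : multi_index N m) : exists w, u w = x a.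
    by have [|w _ <-] := us (x a); [exact: codom_f|exists w].
  by exists n, u, A, B, v.
(* In the first case r <= q, and r = oo is excluded because 1 / q is positive. *)
have [rq|rq] := leP q^-1 (inv_exponent r).
  have [r' rE r'q] : exists2 r', r = r'%:E & r' <= q.
    case: r r1 rq {HX coords} => [r'||]//= r1.
      move=> rq; exists r' => //; rewrite -lef_pV2 ?posrE//.
      by move: r1; rewrite lee_fin; exact: lt_le_trans.
    by rewrite leNgt invr_gt0 q0.
  exists L => // m N x; have [n [u [A [B [v [A0 B0 AB uv uAB]]]]]] := coords m N x.
  apply: le_trans (Lr_coef_le r1 A0 B0 (fun a => (uAB a).1) (fun a => (uAB a).2) uv rE q2 r'q) _.
  by rewrite -mulrA ler_wpM2r// mulr_ge0 ?sqrtr_ge0 ?exprn_ge0.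
have [n0 n0P] := @nat_powR_bound _ _ (C * L) rq.
exists (Num.max 1 (n0%:R * L)) => [|m N x]; first by rewrite le_max lexx.
have [n [u [A [B [v [A0 B0 AB uv uAB]]]]]] := coords m N x.
apply: le_trans (Lr_coef_le_dim r1 A0 B0 (fun a => (uAB a).1) (fun a => (uAB a).2) uv q2) _.
have nn0 : (n <= n0)%N.
  (* These vectors have norm at least 1 / B and their unimodular combinations at most A n ^ (1 / r),
     so cotype gives n ^ (1 / q) <= C A B n ^ (1 / r) with A B <= L. *)
  apply: n0P; pose xk (k : 'I_n) := u (delta_mx 0 k).
  have := @cotype_const_le q C B^-1 (A * n%:R `^ inv_exponent r) n xk q0.
  rewrite invr_ge0 (ltW B0) mulr_ge0 ?(ltW A0) ?powR_ge0// => /(_ isT isT C0 (cot _ _)).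
  rewrite ler_pdivrMr// => H; apply: le_trans (H _ _) _.
  - move=> k; rewrite -[leLHS]mul1r ler_pdivrMr// mulrC.
    apply: le_trans (uAB _).2; apply: le_trans (le_coord_lr_norm _ k r1).
    by rewrite mxE !eqxx rnormC normr1.
  - move=> z z1; rewrite (_ : \sum_(k < n) _ = u (\row_k tnth z k)); last first.
      rewrite [\row_k _]row_sum_delta linear_sum; apply: eq_bigr => k _.
      by rewrite linearZ/= mxE.
    apply: le_trans (uAB _).1 _; rewrite ler_wpM2l ?(ltW A0)//.
    by apply: lr_norm_unimodular => // i; rewrite mxE.
  rewrite (_ : _ * B = C * (A * B) * n%:R `^ inv_exponent r); last by ring.
  by rewrite ler_wpM2r ?powR_ge0// ler_wpM2l// ltW.
rewrite -[A * B * _ * _]mulrA [leLHS]mulrA.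
apply: ler_wpM2r; first by rewrite mulr_ge0 ?sqrtr_ge0 ?exprn_ge0.
rewrite le_max; apply/orP; right; apply: ler_pM => //; last by rewrite ler_nat.
by rewrite mulr_ge0// ltW.
Qed.

End Lr_cotype.

(** * The Hilbert space l_2 *)

Section rnorm_convergence.
Context {R : realType}.

Lemma cvg_rnormP (V : normedModType R[i]) (s : nat -> V) (l : V) :
  (s @ \oo --> l) <-> ((fun n => rnorm (l - s n)) @ \oo --> (0 : R)).
Proof.
split=> [/cvgrPdist_lt sl|/cvgrPdist_lt sl]; apply/cvgrPdist_lt => e e0.
  have eC : (0 : R[i]) < e%:C by rewrite ltcR.
  have := sl _ eC; apply: filterS => n /=.
  by rewrite -rnormE ltcR sub0r normrN ger0_norm ?rnorm_ge0.
have eE : (complex.Re e)%:C = e by rewrite RRe_real// ger0_real// ltW.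
have := sl (complex.Re e); rewrite -ltcR eE => /(_ e0).
apply: filterS => n /=; rewrite sub0r normrN ger0_norm ?rnorm_ge0// => H.
by rewrite -rnormE -eE ltcR.
Qed.

Lemma cvg_rnorm (V : normedModType R[i]) (s : nat -> V) (l : V) :
  s @ \oo --> l -> (fun n => rnorm (s n)) @ \oo --> rnorm l.
Proof.
move=> /cvg_rnormP sl; apply/cvgrPdist_le => e e0.
move/cvgrPdist_le : sl => /(_ _ e0); apply: filterS => n /=.
rewrite sub0r normrN ger0_norm ?rnorm_ge0//; apply: le_trans.
rewrite ler_norml lerNl opprB ler_rnormB andbT.
by apply: le_trans (ler_rnormB _ _) _; rewrite -rnormN opprB.
Qed.

Lemma cvg_lipschitz (V W : normedModType R[i]) (g : V -> W) (K : R) (s : nat -> V) (l : V) :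
  (forall x y, rnorm (g x - g y) <= K * rnorm (x - y)) ->
  s @ \oo --> l -> (g \o s) @ \oo --> g l.
Proof.
move=> gK /cvg_rnormP sl; apply/cvg_rnormP.
apply: (@squeeze_cvgr _ _ _ _ (fun=> 0) (fun n => K * rnorm (l - s n))).
- by apply: nearW => n; rewrite rnorm_ge0 gK.
- exact: cvg_cst.
- by rewrite -[X in _ --> X](mulr0 K); apply: cvgM => //; exact: cvg_cst.
Qed.

Lemma cvg_ReIm (z : nat -> R[i]) (a b : R) :
  (fun n => complex.Re (z n)) @ \oo --> a -> (fun n => complex.Im (z n)) @ \oo --> b ->
  (z : nat -> R[i]^o) @ \oo --> (a +i* b : R[i]^o).
Proof.
move=> za zb; apply/cvg_rnormP.
apply: (@squeeze_cvgr _ _ _ _ (fun=> 0)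
  (fun n => `|a - complex.Re (z n)| + `|b - complex.Im (z n)|)).
- apply: nearW => n; rewrite rnorm_ge0/=; apply: le_trans (rnorm_le_ReIm _) _.
  by case: (z n).
- exact: cvg_cst.
- rewrite -[X in _ --> X](addr0 0); apply: cvgD.
    by rewrite -(normr0 R) -(subrr a); apply: cvg_norm; apply: cvgB => //; exact: cvg_cst.
  by rewrite -(normr0 R) -(subrr b); apply: cvg_norm; apply: cvgB => //; exact: cvg_cst.
Qed.

Lemma cvg_series_nneseries (y : nat -> R) (S : R) : (forall n, 0 <= y n) ->
  (\sum_(0 <= n <oo) (y n)%:E)%E = S%:E -> series y @ \oo --> S.
Proof.
move=> y0 yS.
have : (fun n => \sum_(0 <= i < n) (y i)%:E)%E @ \oo --> S%:E.
  rewrite -yS; apply: is_cvg_nneseries => n _ _; by rewrite lee_fin.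
move=> /fine_cvg; rewrite (_ : fine \o _ = series y)//.
by apply/funext => n /=; rewrite sumEFin.
Qed.

End rnorm_convergence.

Section ell2_dot_theory.
Context {R : realType}.
Implicit Types u v w : ell2 R.

Lemma cvg_sqr_ell2 u : series (fun n => rnorm (u n) ^+ 2) @ \oo --> rnorm u ^+ 2.
Proof.
apply: cvg_series_nneseries => [n|]; first exact: sqr_ge0.
by rewrite -/(sqsum u) sqsum_fin.
Qed.

(** Comparison with |u_n|^2 + |v_n|^2. Taking [g] to be the real or the imaginary part reduces the
    complex series to absolutely convergent real ones. *)
Lemma dot_summable (g : R[i] -> R) u v : (forall z, `|g z| <= rnorm z) ->
  cvgn (series (fun n => g (u n * (v n)^*%R))).
Proof.
move=> gz; apply: normed_cvg.
apply: (@series_le_cvg _ _ (fun n => rnorm (u n) ^+ 2 + rnorm (v n) ^+ 2)) => [n|n|n|].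
- exact: normr_ge0.
- by rewrite addr_ge0// sqr_ge0.
- apply: le_trans (gz _) _; rewrite rnormM rnormJ.
  have := rnorm_ge0 (u n); have := rnorm_ge0 (v n).
  by have := sqr_ge0 (rnorm (u n) - rnorm (v n)); nra.
- rewrite (_ : (fun n => _) = (fun n => rnorm (u n) ^+ 2) + (fun n => rnorm (v n) ^+ 2))//.
  by apply: is_cvg_seriesD; apply/cvg_ex; eexists; exact: cvg_sqr_ell2.
Qed.

(** [ell2_dot] is a [lim], which carries information only once the series is known to converge. *)
Lemma dot_cvg u v :
  series (fun n => u n * (v n)^*%R : R[i]^o) @ \oo --> (ell2_dot u v : R[i]^o).
Proof.
have absRe (z : R[i]) : `|complex.Re z| <= rnorm z.
  by rewrite -lecR rnormE normc_ge_Re.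
have absIm (z : R[i]) : `|complex.Im z| <= rnorm z.
  rewrite -(@ler_pXn2r _ 2)// ?nnegrE ?rnorm_ge0// sqr_rnorm real_normK ?num_real//.
  by rewrite lerDr sqr_ge0.
have /cvg_ex[/= a Ha] := @dot_summable _ u v absRe.
have /cvg_ex[/= b Hb] := @dot_summable _ u v absIm.
suff H : series (fun n => u n * (v n)^*%R : R[i]^o) @ \oo --> (a +i* b : R[i]^o).
  by apply/cvg_ex; exists (a +i* b).
have ImD (z w : R[i]) : complex.Im (z + w) = complex.Im z + complex.Im w.
  by case: z w => [? ?] [? ?].
apply: cvg_ReIm.
  rewrite (_ : (fun n => _) = series (fun n => complex.Re (u n * (v n)^*%R)))//.
  by apply/funext => n; rewrite /series/= Re_sum.
rewrite (_ : (fun n => _) = series (fun n => complex.Im (u n * (v n)^*%R)))//.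
by apply/funext => n; rewrite /series/= (big_morph (@complex.Im R) ImD erefl).
Qed.

Lemma dotP u v (l : R[i]) :
  series (fun n => u n * (v n)^*%R : R[i]^o) @ \oo --> (l : R[i]^o) -> ell2_dot u v = l.
Proof. by move=> H; apply: (cvg_lim _ H); exact: norm_hausdorff. Qed.

Lemma dotDl u v w : ell2_dot (u + v) w = ell2_dot u w + ell2_dot v w.
Proof.
apply: dotP.
have -> : series (fun n => (u + v : ell2 R) n * (w n)^*%R : R[i]^o) =
    series (fun n => u n * (w n)^*%R : R[i]^o) + series (fun n => v n * (w n)^*%R : R[i]^o).
  by rewrite -seriesD; congr series; apply/funext => n; rewrite !fctE -mulrDl.
exact: cvgD (@dot_cvg u w) (@dot_cvg v w).
Qed.

Lemma dotZl (c : R[i]) u w : ell2_dot (c *: u) w = c * ell2_dot u w.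
Proof.
apply: dotP.
have cL (x y : R[i]^o) : rnorm (c * x - c * y : R[i]^o) <= rnorm c * rnorm (x - y).
  by rewrite -mulrBr rnormM.
have := cvg_lipschitz cL (@dot_cvg u w).
rewrite (_ : (fun x : R[i]^o => c * x) \o _ =
  series (fun n => (c *: u : ell2 R) n * (w n)^*%R : R[i]^o))//.
apply/funext => n; rewrite /series/= mulr_sumr; apply: eq_bigr => i _.
by rewrite mulrA.
Qed.

Lemma dotC u v : ell2_dot v u = (ell2_dot u v)^*%R.
Proof.
apply: dotP.
have cL (x y : R[i]^o) : rnorm (x^*%R - y^*%R : R[i]^o) <= 1 * rnorm (x - y).
  by rewrite -rmorphB rnormJ mul1r.
have := cvg_lipschitz cL (@dot_cvg u v).
rewrite (_ : (fun x : R[i]^o => x^*%R) \o _ = series (fun n => v n * (u n)^*%R : R[i]^o))//.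
apply/funext => n; rewrite /series/= rmorph_sum; apply: eq_bigr => i _.
by rewrite rmorphM/= conjCK mulrC.
Qed.

Lemma dot0l w : ell2_dot 0 w = 0.
Proof. by rewrite -(scale0r 0) dotZl mul0r. Qed.

Lemma dotNl u w : ell2_dot (- u) w = - ell2_dot u w.
Proof. by rewrite -scaleN1r dotZl mulN1r. Qed.

Lemma dotBl u v w : ell2_dot (u - v) w = ell2_dot u w - ell2_dot v w.
Proof. by rewrite dotDl dotNl. Qed.

Lemma dotZr (c : R[i]) u w : ell2_dot u (c *: w) = c^*%R * ell2_dot u w.
Proof. by rewrite dotC dotZl rmorphM/= -dotC. Qed.

Lemma dotBr u v w : ell2_dot w (u - v) = ell2_dot w u - ell2_dot w v.
Proof. by rewrite dotC dotBl rmorphB/= -!dotC. Qed.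

Lemma dot_suml I (r : seq I) (Q : pred I) (F : I -> ell2 R) w :
  ell2_dot (\sum_(i <- r | Q i) F i) w = \sum_(i <- r | Q i) ell2_dot (F i) w.
Proof. by apply: (big_morph (fun u => ell2_dot u w)); [move=> ? ?; exact: dotDl|exact: dot0l]. Qed.

Lemma dot_sumr I (r : seq I) (Q : pred I) (F : I -> ell2 R) w :
  ell2_dot w (\sum_(i <- r | Q i) F i) = \sum_(i <- r | Q i) ell2_dot w (F i).
Proof. by rewrite dotC dot_suml rmorph_sum/=; apply: eq_bigr => i _; rewrite -dotC. Qed.

Lemma dot_norm u : ell2_dot u u = (rnorm u ^+ 2)%:C.
Proof.
apply: dotP; apply: cvg_ReIm.
  rewrite (_ : (fun n => _) = series (fun n => rnorm (u n) ^+ 2)); first exact: cvg_sqr_ell2.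
  by apply/funext => n; rewrite /series/= Re_sum; apply: eq_bigr => i _; rewrite sqr_rnormE.
rewrite (_ : (fun n => _) = fun=> 0); first exact: cvg_cst.
apply/funext => n; rewrite /series/=.
suff -> : \sum_(0 <= k < n) u k * (u k)^*%R = (\sum_(0 <= k < n) rnorm (u k) ^+ 2)%:C by [].
rewrite rmorph_sum; apply: eq_bigr => i _.
by rewrite rmorphXn/= rnormE normCK.
Qed.

Lemma dot_norm_Re u : rnorm u ^+ 2 = complex.Re (ell2_dot u u).
Proof. by rewrite dot_norm. Qed.

Lemma orthonormal_rnorm (e : nat -> ell2 R) k : orthonormal_seq e -> rnorm (e k) = 1.
Proof.
move=> eo; apply/eqP; rewrite -(@eqrXn2 _ 2)// ?rnorm_ge0//.
by rewrite dot_norm_Re eo eqxx expr1n.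
Qed.

Section finite_bessel.
Context {I : finType} (Q : pred I) (e : I -> ell2 R).
Hypothesis eo : forall i j, Q i -> Q j -> ell2_dot (e i) (e j) = (i == j)%:R.

Lemma pythagoras (c : I -> R[i]) :
  rnorm (\sum_(i | Q i) c i *: e i) ^+ 2 = \sum_(i | Q i) rnorm (c i) ^+ 2.
Proof.
rewrite dot_norm_Re dot_suml Re_sum; apply: eq_bigr => i Qi.
rewrite dotZl dot_sumr (bigD1 i)//= big1 ?addr0 => [|j /andP[Qj ji]].
  by rewrite dotZr eo// eqxx mulr1 sqr_rnormE.
by rewrite dotZr eo// eq_sym (negbTE ji) mulr0.
Qed.

(** Expand the squared norm of u - w, where w is the projection of u onto the span of the [e i]. *)
Lemma bessel u : \sum_(i | Q i) rnorm (ell2_dot u (e i)) ^+ 2 <= rnorm u ^+ 2.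
Proof.
pose w := \sum_(i | Q i) ell2_dot u (e i) *: e i.
have uw : ell2_dot u w = (\sum_(i | Q i) rnorm (ell2_dot u (e i)) ^+ 2)%:C.
  rewrite /w dot_sumr rmorph_sum; apply: eq_bigr => i _.
  by rewrite dotZr rmorphXn/= rnormE normCK mulrC.
have ww : ell2_dot w w = (\sum_(i | Q i) rnorm (ell2_dot u (e i)) ^+ 2)%:C.
  by rewrite dot_norm pythagoras.
rewrite -subr_ge0; have := sqr_ge0 (rnorm (u - w)).
rewrite (dot_norm_Re (u - w)) dotBl !dotBr uw ww [ell2_dot w u]dotC uw dot_norm.
by rewrite conjcE /= subrr subr0.
Qed.

End finite_bessel.

(** Bessel's inequality for the single vector v / |v|. *)
Lemma cauchy_schwarz u v : rnorm (ell2_dot u v) <= rnorm u * rnorm v.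
Proof.
have [v0|v0] := eqVneq (rnorm v) 0.
  by rewrite (rnorm0_eq0 v0) dotC dot0l rnormJ !rnorm0 mulr0.
pose e := (rnorm v)^-1%:C *: v.
have vpos : 0 < rnorm v by rewrite lt_def v0 rnorm_ge0.
have ee : ell2_dot e e = 1.
  rewrite dot_norm rnormZ rnormC ger0_norm ?invr_ge0 ?rnorm_ge0// mulVf//.
  by rewrite expr1n.
have eo (i j : unit) : xpredT i -> xpredT j -> ell2_dot e e = (i == j)%:R.
  by case: i; case: j.
have := @bessel unit xpredT (fun=> e) eo u.
rewrite big_const card_unit /= addr0.
rewrite ler_pXn2r ?nnegrE ?rnorm_ge0// dotZr rnormM rnormJ rnormC.
by rewrite ger0_norm ?invr_ge0 ?rnorm_ge0// ler_pdivrMl// mulrC.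
Qed.

End ell2_dot_theory.

(** * Bessel families and Gram matrices *)

Section bessel_families.
Local Open Scope sesquilinear_scope.
Context {R : realType}.

Lemma powR_sqr_half (x r : R) : 0 <= x -> (x ^+ 2) `^ (r / 2) = x `^ r.
Proof. by move=> x0; rewrite -powR_mulrn// -powRrM; congr (_ `^ _); field. Qed.

(** Weaker than orthonormality: some vectors may be zero, as happens below when a Gram matrix is
    singular. *)
Definition bessel_family (I : finType) (b : I -> ell2 R) : Prop :=
  forall u, \sum_i rnorm (ell2_dot u (b i)) ^+ 2 <= rnorm u ^+ 2.

(* Singular value decomposition of the synthesis map c |-> sum_j c_j w_j: the
   b_k are its normalized left singular vectors, obtained by diagonalizing the
   Gram matrix of w.  Since the squared moduli of the entries of a unitary
   matrix are doubly stochastic, Jensen's inequality compares the norms of the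
   w_j with the singular values. *)
Lemma bessel_family_dominates (r : R) (n : nat) (w : 'I_n -> ell2 R) : 2 <= r ->
  exists b : 'I_n -> ell2 R, bessel_family b /\
    \sum_j rnorm (w j) `^ r <=
    \sum_k (\sum_j rnorm (ell2_dot (b k) (w j)) ^+ 2) `^ (r / 2).
Proof.
move=> r2; have r0 : 0 < r by apply: lt_le_trans r2.
have rh : 1 <= r / 2 by rewrite ler_pdivlMr ?mul1r.
pose G : 'M[R[i]]_n := \matrix_(i, j) ell2_dot (w i) (w j).
have Gherm : G^t* = G by apply/matrixP => i j; rewrite !mxE -dotC.
have Gnormal : G \is normalmx by rewrite qualifE/= Gherm.
have := orthomx_spectralP Gnormal.
set P := spectralmx G; set D := spectral_diag G.
have Punit : P \is unitarymx by exact: spectral_unitarymx.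
rewrite invmx_unitary// => GE.
have PP : P *m P^t* = 1%:M by exact/unitarymxP.
have PP' : P^t* *m P = 1%:M by rewrite -invmx_unitary// mulVmx// unitarymx_unit.
have rowP1 k : \sum_j rnorm (P k j) ^+ 2 = 1.
  apply: complexI; rewrite rmorph_sum.
  have /matrixP/(_ k k) := PP; rewrite !mxE eqxx => PPk; apply: etrans PPk.
  by apply: eq_bigr => j _; rewrite !mxE rmorphXn/= rnormE normCK.
have colP1 j : \sum_k rnorm (P k j) ^+ 2 = 1.
  apply: complexI; rewrite rmorph_sum.
  have /matrixP/(_ j j) := PP'; rewrite !mxE eqxx => PPj; apply: etrans PPj.
  by apply: eq_bigr => k _; rewrite !mxE rmorphXn/= rnormE normCK mulrC.
(* Rotating [w] by the unitary [P] yields orthogonal vectors, whose squared norms are the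
   eigenvalues [D 0 k] of the Gram matrix. *)
pose v k := \sum_i P k i *: w i.
have PG : P *m G = diag_mx D *m P by rewrite GE !mulmxA PP mul1mx.
have vw k j : ell2_dot (v k) (w j) = D 0 k * P k j.
  rewrite /v dot_suml; transitivity ((P *m G) k j).
    by rewrite mxE; apply: eq_bigr => i _; rewrite dotZl mxE.
  by rewrite PG mul_diag_mx mxE.
have vv k l : ell2_dot (v k) (v l) = D 0 k * (k == l)%:R.
  rewrite {2}/v dot_sumr; under eq_bigr do rewrite dotZr vw mulrCA.
  rewrite -mulr_sumr; congr (_ * _).
  have /matrixP/(_ k l) := PP; rewrite !mxE => <-.
  by apply: eq_bigr => j _; rewrite !mxE mulrC.
pose tau k := rnorm (v k).
have DE k : D 0 k = (tau k ^+ 2)%:C by rewrite -dot_norm vv eqxx mulr1.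
have t0 k : 0 <= tau k by exact: rnorm_ge0.
have wE j : rnorm (w j) ^+ 2 = \sum_k rnorm (P k j) ^+ 2 * tau k ^+ 2.
  apply: complexI; rewrite -dot_norm rmorph_sum.
  have /matrixP/(_ j j) := GE; rewrite mxE => ->.
  rewrite -mulmxA mxE; apply: eq_bigr => k _.
  have Pkj : (rnorm (P k j) ^+ 2)%:C = P k j * (P k j)^*%R.
    by rewrite rmorphXn/= rnormE normCK.
  rewrite mul_diag_mx !mxE DE [RHS]rmorphM/= Pkj; ring.
(* As the inverse of 0 is 0, [b k] vanishes when [tau k] does; the other [b k] are orthonormal. *)
pose b k := (tau k)^-1%:C *: v k.
exists b; split.
  move=> u; rewrite (bigID (fun k => tau k != 0))/= [X in _ + X]big1 ?addr0.
    apply: bessel => i j i0 j0; rewrite dotZl dotZr vv DE.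
    have [->|ij] := eqVneq i j; last by rewrite !mulr0.
    rewrite mulr1 conjcE conjc_real -!rmorphM/=.
    by rewrite expr2 mulKf// mulVf.
  move=> k /negPn/eqP k0; rewrite dotZr k0 invr0 conjcE conjc_real.
  by rewrite mul0r rnorm0 expr0n.
have bw k : \sum_j rnorm (ell2_dot (b k) (w j)) ^+ 2 = tau k ^+ 2.
  under eq_bigr do rewrite dotZl vw !rnormM exprMn rnormC DE rnormC exprMn.
  rewrite -mulr_sumr -mulr_sumr rowP1 mulr1.
  have [->|k0] := eqVneq (tau k) 0; first by rewrite invr0 normr0 !expr0n mul0r.
  rewrite -exprMn; congr (_ ^+ 2).
  by rewrite !ger0_norm ?invr_ge0 ?sqr_ge0// expr2 mulKf.
under [leRHS]eq_bigr do rewrite bw.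
(* Jensen's inequality uses that the columns of |P k j|^2 sum to 1; after exchanging the sums, the
   rows do. *)
apply: (@le_trans _ _ (\sum_j \sum_k rnorm (P k j) ^+ 2 * (tau k ^+ 2) `^ (r / 2))).
  apply: ler_sum => j _; rewrite -powR_sqr_half ?rnorm_ge0// wE.
  apply: (@jensen_powR _ _ xpredT (r / 2) (fun k => rnorm (P k j) ^+ 2) (fun k => tau k ^+ 2)) => //.
  - by move=> k _; exact: sqr_ge0.
  - by rewrite colP1.
  - by move=> k _; exact: sqr_ge0.
rewrite exchange_big/=; apply: ler_sum => k _.
by rewrite -mulr_suml rowP1 mul1r.
Qed.

End bessel_families.

Lemma cvg_finsum (R : realType) I (r : seq I) (Q : pred I) (F : I -> nat -> R) (a : I -> R) :
  (forall i, F i @ \oo --> a i) ->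
  (fun n => \sum_(i <- r | Q i) F i n) @ \oo --> \sum_(i <- r | Q i) a i.
Proof.
move=> Fa; elim: r => [|i r IH].
  by under eq_cvg do rewrite big_nil; rewrite big_nil; exact: cvg_cst.
under eq_cvg do rewrite big_cons; rewrite big_cons.
by case: (Q i) => //; apply: cvgD.
Qed.

(** * Operators with a Schmidt representation *)

Section schmidt_representations.
Context {R : realType} (A : ell2 R -> ell2 R) (s : nat -> R) (e f : nat -> ell2 R).
Hypotheses (s0 : forall n, 0 <= s n) (eo : orthonormal_seq e) (fo : orthonormal_seq f).
Hypothesis Acvg : forall u,
  series (fun n => ((s n)%:C * ell2_dot u (e n)) *: f n) @ \oo --> A u.

Lemma cvg_dotl (x : nat -> ell2 R) (l v : ell2 R) : x @ \oo --> l ->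
  (fun n => ell2_dot (x n) v : R[i]^o) @ \oo --> (ell2_dot l v : R[i]^o).
Proof.
apply: (@cvg_lipschitz _ (ell2 R) (R[i]^o) (fun u => ell2_dot u v) (rnorm v)) => u u'.
by rewrite -dotBl mulrC cauchy_schwarz.
Qed.

(** By continuity of the inner product, since the inner products of the partial sums with [f k] are
    constant from index k + 1 on. *)
Lemma schmidt_dot u k : ell2_dot (A u) (f k) = (s k)%:C * ell2_dot u (e k).
Proof.
have H := @cvg_dotl _ _ (f k) (@Acvg u).
apply: (@cvg_unique (R[i]^o) _ _ _ _ _ H); first exact: norm_hausdorff.
apply: cvg_near_cst; exists k.+1 => // n /= kn.
rewrite /series/= dot_suml big_mkord (bigD1 (Ordinal kn))//= big1 => [|i ik].
  by rewrite addr0 dotZl fo eqxx mulr1.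
by rewrite dotZl fo (_ : (i : nat) == k = false) ?mulr0//; exact/negbTE.
Qed.

Lemma orthonormal_ord (g : nat -> ell2 R) (n : nat) : orthonormal_seq g ->
  forall i j : 'I_n, xpredT i -> xpredT j -> ell2_dot (g i) (g j) = (i == j)%:R.
Proof. by move=> go i j _ _; rewrite go. Qed.

Lemma schmidt_ge k : s k <= rnorm (A (e k)).
Proof.
have := cauchy_schwarz (A (e k)) (f k); rewrite schmidt_dot eo eqxx mulr1.
rewrite rnormC ger0_norm// => /le_trans; apply.
by rewrite (orthonormal_rnorm _ fo) mulr1.
Qed.

(** For the partial sums of A, |S_n b_i|^2 is the sum of |<b_i, e_k>|^2 s_k^2. The weights |<b_i,
    e_k>|^2 have sum at most 1 over k, as |b_i| <= 1, which allows Jensen's inequality, and sum at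
    most 1 over i, as b is a Bessel family. *)
Lemma schmidt_bessel_le (r c : R) (I : finType) (b : I -> ell2 R) : 2 <= r ->
  bessel_family b -> (forall n, \sum_(k < n) s k `^ r <= c) ->
  \sum_i rnorm (A (b i)) `^ r <= c.
Proof.
move=> r2 bb sc; have r0 : 0 < r by apply: lt_le_trans r2.
have rh : 1 <= r / 2 by rewrite ler_pdivlMr ?mul1r.
(* The Bessel inequality tested on [b i] itself gives |b_i|^4 <= |b_i|^2. *)
have b1 i : rnorm (b i) <= 1.
  have := bb (b i); rewrite (bigD1 i)//= dot_norm rnormC ger0_norm ?sqr_ge0//.
  move=> H; rewrite -(@ler_pXn2r _ 2)// ?nnegrE ?rnorm_ge0// expr1n.
  have {}H : (rnorm (b i) ^+ 2) ^+ 2 <= rnorm (b i) ^+ 2.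
    by apply: le_trans H; rewrite lerDl sumr_ge0// => j _; exact: sqr_ge0.
  by rewrite leNgt; apply/negP => H1; nra.
pose S n u := series (fun n => ((s n)%:C * ell2_dot u (e n)) *: f n) n.
suff HS n : \sum_i rnorm (S n (b i)) `^ r <= c.
  pose a i := rnorm (A (b i)).
  (* The limit is taken in the tangent lower bound, which is affine in the norms of the partial sums
     and tends to the sum of a_i ^ r. *)
  pose y n := \sum_i (a i `^ r + r * a i `^ (r - 1) * (rnorm (S n (b i)) - a i)).
  have cy : y @ \oo --> \sum_i (a i `^ r + r * a i `^ (r - 1) * (a i - a i)).
    apply: cvg_finsum => i; apply: cvgD; first exact: cvg_cst.
    apply: cvgM; first exact: cvg_cst.
    apply: cvgB; last exact: cvg_cst.
    exact/cvg_rnorm/Acvg.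
  under eq_bigr do rewrite -/(a _).
  rewrite (eq_bigr (fun i => a i `^ r + r * a i `^ (r - 1) * (a i - a i))); last first.
    by move=> i _; rewrite subrr mulr0 addr0.
  apply: (cvgr_to_le cy); apply: nearW => n; apply: le_trans (HS n).
  apply: ler_sum => i _; apply: powR_tangent; rewrite ?rnorm_ge0//.
  by apply: le_trans r2; rewrite ler1n.
have SE u : rnorm (S n u) ^+ 2 = \sum_(k < n) rnorm (ell2_dot u (e k)) ^+ 2 * s k ^+ 2.
  rewrite /S /series/= big_mkord (pythagoras (Q := xpredT) (e := fun i : 'I_n => f i)).
    by apply: eq_bigr => k _; rewrite rnormM exprMn rnormC real_normK ?num_real// mulrC.
  exact: orthonormal_ord.
apply: (@le_trans _ _ (\sum_i \sum_(k < n) rnorm (ell2_dot (b i) (e k)) ^+ 2 * s k `^ r)).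
  apply: ler_sum => i _; rewrite -powR_sqr_half ?rnorm_ge0// SE.
  under [leRHS]eq_bigr do rewrite -powR_sqr_half//.
  apply: (@jensen_powR _ _ xpredT (r / 2)
    (fun k : 'I_n => rnorm (ell2_dot (b i) (e k)) ^+ 2) (fun k => s k ^+ 2)) => //.
  - by move=> k _; exact: sqr_ge0.
  - apply: le_trans (bessel (e := fun i : 'I_n => e i) (orthonormal_ord (n := n) eo) _) _.
    by rewrite expr_le1// rnorm_ge0.
  - by move=> k _; exact: sqr_ge0.
rewrite exchange_big/=; apply: le_trans (sc n); apply: ler_sum => k _.
rewrite -mulr_suml ler_piMl ?powR_ge0//.
under eq_bigr do rewrite dotC rnormJ.
apply: le_trans (bb _) _.
by rewrite dot_norm_Re eo eqxx.
Qed.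

End schmidt_representations.

(** * Schatten classes *)

Section schatten_representation.
Context {R : realType}.

Lemma lr_seq_norm_cvg (r c : R) (s : nat -> R) : 0 < r -> (forall n, 0 <= s n) ->
  lr_seq_norm r s = c%:E ->
  (fun n => \sum_(k < n) s k `^ r) @ \oo --> c `^ r.
Proof.
move=> r0 s0; rewrite /lr_seq_norm.
set S := (\sum_(0 <= n <oo) _)%E => Sc.
have S0 : (0 <= S)%E by apply: nneseries_ge0 => n _ _; rewrite lee_fin powR_ge0.
have [x x0 Sx] : exists2 x : R, 0 <= x & S = x%:E.
  case: S S0 Sc => [x||]//; first by rewrite lee_fin => x0 _; exists x.
  by rewrite poweRyr ?invr_eq0 ?gt_eqF.
have xc : x = c `^ r.
  move: Sc; rewrite Sx poweR_EFin => -[<-].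
  by rewrite powRVK.
rewrite -xc (_ : (fun n => _) = series (fun n => s n `^ r)).
  by apply: cvg_series_nneseries => // n; exact: powR_ge0.
by apply/funext => n; rewrite /series/= big_mkord.
Qed.

Lemma partial_sum_le (r c : R) (s : nat -> R) :
  (fun n => \sum_(k < n) s k `^ r) @ \oo --> c ->
  forall n, \sum_(k < n) s k `^ r <= c.
Proof.
move=> sc n; apply: (cvgr_to_ge sc); exists n => // k /= nk.
rewrite -!(big_mkord xpredT (fun i => s i `^ r)) (big_cat_nat (leq0n n) nk)//= lerDl.
by apply: sumr_ge0 => i _; exact: powR_ge0.
Qed.

End schatten_representation.

Section schatten_hypercontractive.
Context {R : realType} (X : completeNormedModType R[i]) (r : R).
Hypothesis r2 : 2 <= r.
Context (J : {linear X -> (ell2 R -> ell2 R)}).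
Hypothesis HJ : forall x, schatten r%:E (J x) (rnorm x).

Let r0 : 0 < r. Proof. exact: lt_le_trans r2. Qed.

(** The data form one triple so that [choice] can select them for a whole family of operators. *)
Lemma schatten_schmidt x : exists sef : (nat -> R) * (nat -> ell2 R) * (nat -> ell2 R),
  [/\ forall n, 0 <= sef.1.1 n, orthonormal_seq sef.1.2, orthonormal_seq sef.2,
    forall u, series (fun n => ((sef.1.1 n)%:C * ell2_dot u (sef.1.2 n)) *: sef.2 n) @ \oo --> J x u
    & (fun n => \sum_(k < n) sef.1.1 k `^ r) @ \oo --> rnorm x `^ r].
Proof.
have [_ [s [s0 [e [f [eo fo cv]]]] sn]] := HJ x.
by exists (s, e, f); split => //=; exact: lr_seq_norm_cvg.
Qed.

Lemma schatten_bessel_le (I : finType) (b : I -> ell2 R) x : bessel_family b ->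
  \sum_i rnorm (J x (b i)) `^ r <= rnorm x `^ r.
Proof.
move=> bb; have [[[s e] f] /= [s0 eo fo cv sc]] := schatten_schmidt x.
by apply: (schmidt_bessel_le s0 eo fo cv) => //; exact: partial_sum_le.
Qed.

Context {N m : nat} (x : multi_index N m -> X).
Local Notation T := (measurableTypeR R).
Local Notation P := (torus_prob N).
Local Notation mono t a := (monomial (map_tuple (@expi R) t) a).

Let f (t : N.-tuple T) := \sum_(a | degree a == m) mono t a *: x a.

Let Jf t u : J (f t) u = \sum_(a | degree a == m) mono t a *: J (x a) u.
Proof.
rewrite /f linear_sum.
rewrite (_ : (\sum_(a | degree a == m) J (mono t a *: x a)) u =
   \sum_(a | degree a == m) J (mono t a *: x a) u).
  by apply: eq_bigr => a _; rewrite linearZ.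
by rewrite fct_sumE.
Qed.

Lemma parseval_ell2 (y : multi_index N m -> ell2 R) :
  \int[P]_t (rnorm (\sum_(a | degree a == m) mono t a *: y a) ^+ 2) =
  \sum_(a | degree a == m) rnorm (y a) ^+ 2.
Proof.
under eq_Rintegral do under eq_bigr do rewrite monomial_expi.
pose G a b := ell2_dot (y a) (y b).
transitivity (\int[P]_t gram_sum (fun a => degree a == m) (fun a : multi_index N m => multi_exp a) G t).
  apply: eq_Rintegral => t _; rewrite dot_norm_Re dot_suml Re_sum.
  apply: eq_bigr => a _; rewrite dot_sumr Re_sum; apply: eq_bigr => b _.
  by congr complex.Re; rewrite dotZl dotZr /G; ring.
rewrite parseval_gram_sum => [|a b _ _]; last exact: multi_exp_inj.
by under [RHS]eq_bigr do rewrite dot_norm_Re.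
Qed.

Lemma schatten_coef_le : \sum_(a | degree a == m) rnorm (x a) `^ r <=
  (\int[P]_t (rnorm (f t) ^+ 2)) `^ (r / 2).
Proof.
have rh : 1 <= r / 2 by rewrite ler_pdivlMr ?mul1r.
have rh0 : 0 < r / 2 by apply: lt_le_trans rh.
have /choice[sef Hsef] (a : multi_index N m) := schatten_schmidt (x a).
pose s a := (sef a).1.1; pose e a := (sef a).1.2; pose g a := (sef a).2.
have s0 a n : 0 <= s a n by have [H _ _ _ _] := Hsef a; exact: H.
have eo a : orthonormal_seq (e a) by have [] := Hsef a.
have go a : orthonormal_seq (g a) by have [] := Hsef a.
have sg a u k : ell2_dot (J (x a) u) (g a k) = (s a k)%:C * ell2_dot u (e a k).
  by have [_ _ _ cv _] := Hsef a; exact: (schmidt_dot (go a) cv).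
have sc a : (fun n => \sum_(k < n) s a k `^ r) @ \oo --> rnorm (x a) `^ r.
  by have [] := Hsef a.
have sumc : (fun n => \sum_(a | degree a == m) \sum_(k < n) s a k `^ r) @ \oo -->
    \sum_(a | degree a == m) rnorm (x a) `^ r by apply: cvg_finsum.
(* Only the first [M] singular numbers of each coefficient are kept, which makes the Gram matrix
   finite. *)
apply: (cvgr_to_le sumc); apply: nearW => M.
pose I : finType := (multi_index N m * 'I_M)%type.
(* The zero vectors off degree m let the index type be a full product. *)
pose V (j : I) : ell2 R := if degree j.1 == m then (s j.1 j.2)%:C *: e j.1 j.2 else 0.
pose W (j : 'I_#|I|) := V (enum_val j).
have sumI (F : I -> R) : \sum_(j < #|I|) F (enum_val j) = \sum_a \sum_(k < M) F (a, k).
  transitivity (\sum_(j in I) F j); first by rewrite [RHS]big_enum_val.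
  by rewrite pair_big/=; apply: eq_bigr => -[a k] _.
have [b [bb Wb]] := bessel_family_dominates W r2.
have -> : \sum_(a | degree a == m) \sum_(k < M) s a k `^ r = \sum_j rnorm (W j) `^ r.
  rewrite (sumI (fun j => rnorm (V j) `^ r)) big_mkcond; apply: eq_bigr => a _.
  rewrite /V/=; case: ifP => _; last first.
    by rewrite big1// => k _; rewrite rnorm0 powR0// gt_eqF.
  apply: eq_bigr => k _; rewrite rnormZ rnormC ger0_norm//.
  by rewrite (orthonormal_rnorm _ (eo a)) mulr1.
apply: le_trans Wb _.
pose h k t := rnorm (J (f t) (b k)) ^+ 2.
have bh k : bounded_mfun (h k).
  apply: bounded_mfunX; under [X in bounded_mfun X]eq_fun do rewrite Jf.
  exact: bounded_mfun_rnorm_monomials.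
(* By [sg], s_{a,n} <b_k, e_{a,n}> is the inner product of x_a b_k with the left singular vector
   [g a n]; Bessel's inequality bounds the sum over n by |x_a b_k|^2, and Parseval sums over a. *)
have Eh k : \sum_j rnorm (ell2_dot (b k) (W j)) ^+ 2 <= \int[P]_t h k t.
  rewrite /h; under [leRHS]eq_Rintegral do rewrite Jf.
  rewrite parseval_ell2 (sumI (fun j => rnorm (ell2_dot (b k) (V j)) ^+ 2)).
  rewrite [leRHS]big_mkcond; apply: ler_sum => a _.
  rewrite /V/=; case: ifP => _; last first.
    by rewrite big1// => i _; rewrite dotC dot0l rnormJ rnorm0 expr0n.
  apply: le_trans (bessel (e := fun i : 'I_M => g a i) (orthonormal_ord (n := M) (go a)) _).
  apply: ler_sum => i _; rewrite sg dotZr !rnormM rnormJ; exact: lexx.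
apply: (@le_trans _ _ (lp xpredT (r / 2) (fun k => \int[P]_t h k t) `^ (r / 2))).
  rewrite lp_powR//; apply: ler_sum => k _; apply: ler_powR2; rewrite ?(ltW rh0)//.
  by apply: sumr_ge0 => j _; exact: sqr_ge0.
apply: ler_powR2; [exact: ltW|exact: lp_ge0|].
apply: (@lp_Rint_le _ _ _ P _ (r / 2) h (fun t => rnorm (f t) ^+ 2) rh bh).
- by move=> k t; exact: sqr_ge0.
- apply: bounded_mfunX; exact: bounded_mfun_rnorm_monomials.
- move=> t; apply: ler_powRV; [by []|exact: sum_powR_ge0|exact: sqr_ge0|].
  rewrite powR_sqr_half ?rnorm_ge0//; apply: le_trans (schatten_bessel_le (f t) bb).
  by apply: ler_sum => k _; rewrite /h powR_sqr_half ?rnorm_ge0.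
Qed.

End schatten_hypercontractive.

(** Passing from l_q to l_r and applying [schatten_coef_le] loses no factor, so the constant is 1 in
    every degree. *)
Lemma schatten_hypercontractive (R : realType) (X : completeNormedModType R[i]) (r q : R) :
  2 <= r -> r <= q -> is_schatten_class r%:E X ->
  hypercontractive_homogeneous_cotype X q.
Proof.
move=> r2 rq [J [HJ _]]; exists 1 => // m N x _; rewrite expr1n mul1r.
have r0 : 0 < r by apply: lt_le_trans r2.
rewrite -/(lp (fun a : multi_index N m => degree a == m) q (fun a => rnorm (x a))).
apply: (@le_trans _ _ (lp (fun a : multi_index N m => degree a == m) r (fun a => rnorm (x a)))).
  by apply: lp_le_lp => // a _; exact: rnorm_ge0.
apply: ler_powRV => //; first exact: sum_powR_ge0.
apply: le_trans (schatten_coef_le r2 HJ x) _.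
rewrite -[X in X `^ _]sqr_sqrtr; last by apply: Rint_ge0 => t; exact: sqr_ge0.
by rewrite powR_sqr_half ?sqrtr_ge0.
Qed.

(** * Diagonal matrix units in the Schatten classes *)

Section matrix_units.
Context {R : realType}.
Implicit Types u v : ell2 R.

Lemma nneseries_delta (k : nat) (g : nat -> R) : (forall n, 0 <= g n) ->
  (forall n, n != k -> g n = 0) -> (\sum_(0 <= n <oo) (g n)%:E)%E = (g k)%:E.
Proof.
move=> g0 gk; rewrite (@nneseriesD1 _ _ k xpredT)//; last first.
  by move=> n _; rewrite lee_fin.
by rewrite eseries0 ?adde0// => n _ /andP[_ nk]; rewrite gk.
Qed.

Definition basis_seq (k : nat) : nat -> R[i] := fun n => (n == k)%:R.

Lemma basis_seq_summable k : basis_seq k \in square_summable.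
Proof.
apply/asboolP; rewrite /sqsum (@nneseries_delta k); first exact: ltry.
  by move=> n; exact: sqr_ge0.
by move=> n nk; rewrite /basis_seq (negbTE nk) rnorm0 expr0n.
Qed.

Definition ell2_basis k : ell2 R := Ell2 (basis_seq_summable k).

Lemma dot_basis u k : ell2_dot u (ell2_basis k) = u k.
Proof.
apply: dotP; apply: cvg_near_cst; exists k.+1 => // n /= kn.
rewrite /series/= big_mkord (bigD1 (Ordinal kn))//= big1 => [|i ik].
  by rewrite addr0 /basis_seq eqxx conjC1 mulr1.
rewrite /basis_seq (_ : (i : nat) == k = false) ?conjC0 ?mulr0//.
exact/negbTE.
Qed.

Lemma ell2_basis_orthonormal : orthonormal_seq ell2_basis.
Proof. by move=> i j; rewrite dot_basis /= /basis_seq eq_sym. Qed.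

Lemma rnorm_basis k : rnorm (ell2_basis k) = 1.
Proof. exact: orthonormal_rnorm ell2_basis_orthonormal. Qed.

Lemma le_coord_rnorm u k : rnorm (u k) <= rnorm u.
Proof.
by rewrite -dot_basis; apply: le_trans (cauchy_schwarz _ _) _; rewrite rnorm_basis mulr1.
Qed.

Definition matrix_unit k (u : ell2 R) : ell2 R := u k *: ell2_basis k.

Lemma matrix_unit_linear k : linear (matrix_unit k).
Proof.
by move=> c u v; rewrite /matrix_unit scalerA -scalerDl.
Qed.

(** The image of the unit ball lies in the compact image of the square [-1, 1]^2 under (a, b) |-> (a
    + i b) e_k. *)
Lemma matrix_unit_compact k : compact_operator (matrix_unit k).
Proof.
split; first exact: matrix_unit_linear.
pose phi (p : R * R) : ell2 R := (p.1 +i* p.2) *: ell2_basis k.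
have cphi : continuous phi.
  move=> [a b]; apply/cvgrPdist_lt => e e0.
  have eE : (complex.Re e)%:C = e by rewrite RRe_real// ger0_real// ltW.
  have e2 : 0 < complex.Re e / 2 by rewrite divr_gt0// -ltcR eE.
  have /cvgrPdist_lt/(_ _ e2) H1 : fst @ nbhs (a, b) --> a by exact: cvg_fst.
  have /cvgrPdist_lt/(_ _ e2) H2 : snd @ nbhs (a, b) --> b by exact: cvg_snd.
  near=> p; rewrite -rnormE -eE ltcR /phi -scalerBl rnormZ rnorm_basis mulr1.
  apply: le_lt_trans (rnorm_le_ReIm _) _ => /=.
  have h1 : `|a - p.1| < complex.Re e / 2 by near: p.
  have h2 : `|b - p.2| < complex.Re e / 2 by near: p.
  by rewrite (splitr (complex.Re e)) ltrD.
pose K := phi @` (`[-1, 1] `*` `[-1, 1]).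
have cK : compact K.
  apply: continuous_compact; first exact: continuous_subspaceT.
  by apply: compact_setX; exact: segment_compact.
apply: (subclosed_compact _ cK); first exact: closed_closure.
have clK : closed K by apply: compact_closed cK; exact: norm_hausdorff.
rewrite ((closure_id K).1 clK); apply: closureS => _ [u /= u1 <-].
have uk : rnorm (u k) <= 1 by apply: le_trans u1; exact: le_coord_rnorm.
exists (complex.Re (u k), complex.Im (u k)); last by rewrite /phi /matrix_unit/=; case: (ell2_seq u k).
have ReIm := sqr_rnorm (u k).
have := rnorm_ge0 (u k) => uk0.
have uk2 : rnorm (u k) ^+ 2 <= 1 by rewrite expr_le1.
split=> /=; rewrite in_itv/= -ler_norml -(@ler_pXn2r _ 2)// ?nnegrE// expr1n
  real_normK ?num_real//; apply: le_trans uk2; rewrite ReIm.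
  by rewrite lerDl sqr_ge0.
by rewrite lerDr sqr_ge0.
Unshelve. all: by end_near. Qed.

Lemma schatten_matrix_unit (r : \bar R) k : (2 <= r)%E -> schatten r (matrix_unit k) 1.
Proof.
case: r => [r||]//=.
  rewrite lee_fin => r2; have r0 : 0 < r by apply: lt_le_trans r2.
  split; first exact: matrix_unit_compact.
  exists (fun n => (n == k)%:R).
    split=> //; exists ell2_basis, ell2_basis; split; try exact: ell2_basis_orthonormal.
    move=> u; apply: cvg_near_cst; exists k.+1 => // n /= kn.
    rewrite /series/= big_mkord (bigD1 (Ordinal kn))//= big1 => [|i ik].
      by rewrite addr0 eqxx mul1r dot_basis.
    by rewrite (_ : (i : nat) == k = false) ?mul0r ?scale0r//; exact/negbTE.
  rewrite /lr_seq_norm (@nneseries_delta k); first by rewrite eqxx powR1 poweR1r.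
    by move=> n; exact: powR_ge0.
  by move=> n nk; rewrite (negbTE nk) powR0// gt_eqF.
move=> _; split; first exact: matrix_unit_compact.
apply/eqP; rewrite eq_le; apply/andP; split.
  apply: ge_ereal_sup => _ [u /= u1 <-]; rewrite lee_fin rnormZ rnorm_basis mulr1.
  by apply: le_trans u1; exact: le_coord_rnorm.
apply: ereal_sup_ubound; exists (ell2_basis k); first by rewrite /= rnorm_basis.
by rewrite /matrix_unit /= /basis_seq eqxx scale1r rnorm_basis.
Qed.

End matrix_units.

Section schatten_cotype.
Context {R : realType} (X : completeNormedModType R[i]) (r : \bar R).
Hypothesis r2 : (2 <= r)%E.
Context (J : {linear X -> (ell2 R -> ell2 R)}).
Hypothesis HJ : forall x, schatten r (J x) (rnorm x).
Context (x : nat -> X).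
Hypothesis Jx : forall k, J (x k) = matrix_unit k.

(** For finite r, a single vector of norm at most 1 is a Bessel family, to which
    [schatten_bessel_le] applies. *)
Lemma schatten_rnorm_ge u y : rnorm u <= 1 -> rnorm (J y u) <= rnorm y.
Proof.
move=> u1.
case: r r2 HJ => [r'||]// r'2 HJ'.
  have r2' : 2 <= r' by rewrite -lee_fin.
  have r'0 : 0 < r' by apply: lt_le_trans r2'.
  have bb : bessel_family (fun _ : unit => u).
    move=> v; rewrite big_const card_unit /= addr0 lerXn2r ?nnegrE ?rnorm_ge0//.
    by apply: le_trans (cauchy_schwarz _ _) _; rewrite ler_piMr ?rnorm_ge0.
  have := schatten_bessel_le r2' HJ' y bb; rewrite big_const card_unit /= addr0.
  move=> H; rewrite -(powR_invK r'0 (rnorm_ge0 _)) -(powR_invK r'0 (rnorm_ge0 y)).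
  by apply: ler_powR2 => //; [rewrite invr_ge0 ltW|exact: powR_ge0].
have [_ /esym nE] := HJ' y; rewrite -lee_fin nE.
by apply: ereal_sup_ubound; exists u.
Qed.

Lemma rnorm_unit_ge k : 1 <= rnorm (x k).
Proof.
have := @schatten_rnorm_ge (ell2_basis k) (x k); rewrite rnorm_basis lexx => /(_ isT).
by rewrite Jx /matrix_unit /= /basis_seq eqxx scale1r rnorm_basis.
Qed.

Section diagonal.
Context (N : nat) (z : 'I_N -> R[i]).
Hypothesis z1 : forall k, rnorm (z k) = 1.
Let y := \sum_(k < N) z k *: x k.

Let JyE u : J y u = \sum_(k < N) (z k * u k) *: ell2_basis k.
Proof.
rewrite /y linear_sum fct_sumE; apply: eq_bigr => k _.
by rewrite linearZ/= Jx /matrix_unit -scalerA.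
Qed.

Let sqr_Jy u : rnorm (J y u) ^+ 2 = \sum_(k < N) rnorm (ell2_dot u (ell2_basis k)) ^+ 2.
Proof.
rewrite JyE (pythagoras (Q := xpredT) (e := fun k : 'I_N => ell2_basis k)).
  by apply: eq_bigr => k _; rewrite rnormM z1 mul1r dot_basis.
exact: orthonormal_ord ell2_basis_orthonormal.
Qed.

Let Jy_le u : rnorm (J y u) <= rnorm u.
Proof.
rewrite -(@ler_pXn2r _ 2)// ?nnegrE ?rnorm_ge0// sqr_Jy.
by apply: (bessel (e := fun i : 'I_N => ell2_basis i) (orthonormal_ord (n := N) ell2_basis_orthonormal)).
Qed.

(** The Schmidt representation supplied by [schatten] is arbitrary, so its singular numbers are only
    estimated: s_n <= |y e_n| <= 1 and r >= 2 give s_n ^ r <= |y e_n|^2, and the sum of these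
    squares is at most N by Bessel's inequality for each basis vector. *)
Lemma rnorm_diagonal_le : rnorm y <= N%:R `^ inv_exponent r.
Proof.
case: r r2 HJ => [r'||]// r'2 HJ'; last first.
  have [_ nE] := HJ' y; rewrite -lee_fin -nE powRr0.
  apply: ge_ereal_sup => _ [u /= u1 <-]; rewrite lee_fin.
  exact: le_trans (Jy_le u) u1.
have r2' : 2 <= r' by rewrite -lee_fin.
have r'0 : 0 < r' by apply: lt_le_trans r2'.
apply: ler_powR_inv => //; first exact: rnorm_ge0.
have [[[s e] f] /= [s0 eo fo cv sc]] := schatten_schmidt r2' HJ' y.
apply: (cvgr_to_le sc); apply: nearW => M.
apply: (@le_trans _ _ (\sum_(n < M) \sum_(k < N) rnorm (ell2_dot (ell2_basis k) (e n)) ^+ 2)).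
  apply: ler_sum => n _; under [leRHS]eq_bigr do rewrite dotC rnormJ.
  rewrite -sqr_Jy; apply: (@le_trans _ _ (rnorm (J y (e n)) `^ r')).
    apply: ler_powR2; [exact: ltW|exact: s0|exact: (schmidt_ge s0 eo fo cv)].
  have := Jy_le (e n); rewrite (orthonormal_rnorm _ eo).
  have := rnorm_ge0 (J y (e n)); rewrite le_eqVlt => /predU1P[<- _|a0 a1].
    by rewrite powR0 ?expr0n// gt_eqF.
  by rewrite -powR_mulrn ?(ltW a0)//; apply: ger_powR => //; rewrite a0.
rewrite exchange_big/= -[X in X%:R]card_ord -sumr_const; apply: ler_sum => k _.
apply: le_trans (bessel (e := fun i : 'I_M => e i) (orthonormal_ord (n := M) eo) _) _.
by rewrite rnorm_basis expr1n.
Qed.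

End diagonal.
End schatten_cotype.

(** On the first N diagonal matrix units cotype gives N ^ (1 / q) <= C N ^ (1 / r) for every N,
    which forces 1 / q <= 1 / r. *)
Lemma schatten_cotype_exponent (R : realType) (X : completeNormedModType R[i])
    (r : \bar R) (q : R) : (2 <= r)%E -> 2 <= q -> is_schatten_class r X ->
  cotype X q -> exists2 r', r = r'%:E & r' <= q.
Proof.
move=> r2 q2 [J [HJ HJs]] [C C0 cot].
have q0 : 0 < q by apply: lt_le_trans q2.
have /choice[x Jx] k : exists x, J x = matrix_unit k.
  exact/HJs/schatten_matrix_unit.
have [rq|rq] := leP q^-1 (inv_exponent r).
  case: r r2 rq {HJ HJs} => [r'||]//= r2 rq; last by move: rq; rewrite leNgt invr_gt0 q0.
  exists r' => //; rewrite -lef_pV2 ?posrE//.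
  by move: r2; rewrite lee_fin; apply: lt_le_trans.
have [n0 n0P] := @nat_powR_bound R _ _ C rq.
suff : (n0.+1 <= n0)%N by rewrite ltnn.
apply: n0P; rewrite -[leLHS]mulr1.
apply: (cotype_const_le q0 ler01 (powR_ge0 _ _) C0 (cot _ (fun k : 'I_n0.+1 => x k))).
- by move=> k; exact: (rnorm_unit_ge r2 HJ Jx).
- by move=> z z1; exact: (rnorm_diagonal_le r2 HJ Jx).
Qed.

(** * The case of degree one *)

Section linear_multi_indices.
Context {R : realType} {N : nat}.

Definition unit_index (k : 'I_N) : multi_index N 1 := [ffun i => inord (i == k)].

Lemma unit_indexE k i : unit_index k i = (i == k) :> nat.
Proof. by rewrite ffunE inordK//; case: (i == k). Qed.

Lemma unit_index_inj : injective unit_index.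
Proof.
move=> k l /ffunP/(_ k)/(congr1 val); rewrite /= !unit_indexE eqxx.
by case: eqP.
Qed.

Lemma degree_unit_index k : degree (unit_index k) = 1%N.
Proof.
rewrite /degree (bigD1 k)//= unit_indexE eqxx big1 ?addn0// => i ik.
by rewrite unit_indexE (negbTE ik).
Qed.

Lemma degree1_unit_index (a : multi_index N 1) : degree a == 1%N ->
  exists k, a = unit_index k.
Proof.
move=> /eqP a1; have [k ak] : exists k, a k != 0%N :> nat.
  apply/existsP; apply: contraT; rewrite negb_exists => /forallP a0.
  by move: a1; rewrite /degree big1// => i _; apply/eqP; have := a0 i; rewrite negbK.
exists k; apply/ffunP => i; apply/val_inj; rewrite /= unit_indexE.
move: a1; rewrite /degree (bigD1 k)//=.
have -> : a k = 1%N :> nat.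
  by apply/eqP; rewrite eqn_leq lt0n ak -ltnS ltn_ord.
rewrite add1n => -[/eqP s0]; have [->|ik] := eqVneq i k.
  by apply/eqP; rewrite eqn_leq lt0n ak -ltnS ltn_ord.
by move: s0; rewrite (bigD1 i)//= addn_eq0 => /andP[/eqP].
Qed.

Lemma sum_degree1 (V : nmodType) (F : multi_index N 1 -> V) :
  \sum_(a | degree a == 1%N) F a = \sum_k F (unit_index k).
Proof.
rewrite (partition_big unit_index (fun a => degree a == 1%N))/=; last first.
  by move=> k _; rewrite degree_unit_index.
apply: eq_bigr => a /degree1_unit_index[k ->].
rewrite (big_pred1 k)// => l; exact: (inj_eq unit_index_inj).
Qed.

Lemma monomial_unit_index (z : N.-tuple R[i]) k : monomial z (unit_index k) = tnth z k.
Proof.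
rewrite /monomial (bigD1 k)//= unit_indexE eqxx expr1 big1 ?mulr1// => i ik.
by rewrite unit_indexE (negbTE ik) expr0.
Qed.

End linear_multi_indices.

(** Cotype is the case m = 1: the multi-indices of degree one correspond to the variables, and C ^ 1
    = C. *)
Lemma hypercontractive_cotype (R : realType) (X : completeNormedModType R[i]) (q : R) :
  hypercontractive_homogeneous_cotype X q -> cotype X q.
Proof.
move=> [C C0 H]; exists C => // N x.
pose y (a : multi_index N 1) : X := \sum_(k | unit_index k == a) x k.
have yx k : y (unit_index k) = x k.
  by rewrite /y (big_pred1 k)// => l; exact: (inj_eq unit_index_inj).
have := H 1%N N y isT; rewrite expr1 sum_degree1.
under eq_bigr do rewrite yx.
rewrite /torus_int; under eq_Rintegral do rewrite sum_degree1.
under eq_Rintegral do under eq_bigr do rewrite monomial_unit_index yx.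
by [].
Qed.

Theorem corollary2p5 (R : realType) (X : completeNormedModType R[i])
    (r : \bar R)
    (hX : ((1 <= r)%E /\ Lr_space X r) \/ ((2 <= r)%E /\ is_schatten_class r X))
    (q : R) (hq : 2 <= q) :
  cotype X q <-> hypercontractive_homogeneous_cotype X q.
Proof.
split; last exact: hypercontractive_cotype.
case: hX => [[r1 HX]|[r2 HX]] cot; first exact: Lr_cotype_hypercontractive HX cot.
have [r' rE r'q] := schatten_cotype_exponent r2 hq HX cot; rewrite rE in r2 HX.
exact: schatten_hypercontractive r'q HX.
Qed.
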